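(* For all integers $k\ge 0$ and $n\ge 1$ we have $\mathcal{I}_{k,n}=\mathcal{I}^{\star}_{k,n}$. In particular, for $k=1$: (1) $\mathrm{QSym}_n^+$ has a $\mathbb{Z}$-basis given by $\{\mathfrak{P}_F:F\in\mathsf{LTFor}_n\setminus\mathsf{For}_n\}$. (2) $\mathrm{QSCoinv}_n$ has a $\mathbb{Z}$-basis given by (the images of) $\{\mathfrak{P}_F:F\in\mathsf{For}_n\}$. In particular its dimension (rank over $\mathbb{Z}$) is the Catalan number $\mathrm{Cat}_n=\frac{1}{n+1}\binom{2n}{n}$.
   Context: $\mathbb{N}=\{1,2,\ldots\}$, $[n]=\{1,\ldots,n\}$, $\mathrm{Pol}_n=\mathbb{Z}[x_1,\ldots,x_n]$. $\mathrm{QSym}_n\subset \mathrm{Pol}_n$ is the ring of polynomials such that for every sequence $a_1,\ldots,a_k\ge 1$ the coefficients of $x_{i_1}^{a_1}\cdots x_{i_k}^{a_k}$ and $x_{j_1}^{a_1}\cdots x_{j_k}^{a_k}$ are equal whenever $1\le i_1<\cdots<i_k\le n$ and $1\le j_1<\cdots<j_k\le n$. $\mathrm{QSym}_n^+$ is the ideal of $\mathrm{Pol}_n$ generated by all $f\in\mathrm{QSym}_n$ with zero constant term, and $\mathrm{QSCoinv}_n=\mathrm{Pol}_n/\mathrm{QSym}_n^+$. $\mathcal{I}_{k,n}\subset\mathrm{Pol}_n$ is the ideal generated by all homogeneous $f\in\mathrm{QSym}_n$ with $\deg f\ge k$ (so $\mathcal{I}_{1,n}=\mathrm{QSym}_n^+$).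 Forests: a binary tree is a finite rooted plane tree in which each node is either a leaf (no children) or internal, having an ordered pair of children $v_L,v_R$; $\ast$ is the tree with a single node (a leaf). An indexed forest is an infinite sequence $F=(T_1,T_2,\ldots)$ of binary trees, all but finitely many equal to $\ast$; $\mathsf{For}$ is the set of indexed forests, and $\varnothing$ is the forest all of whose trees are $\ast$. The leaves of $F$, read from left to right, are identified with $1,2,3,\ldots$. $\mathrm{IN}(F)$ is the finite set of internal nodes, $|F|=|\mathrm{IN}(F)|$. For $v\in \mathrm{IN}(F)$, $\rho_F(v)$ is the leaf reached from $v$ by repeatedly passing to the left child. A node $v\in\mathrm{IN}(F)$ is terminal if both its children are leaves; $\mathrm{LTer}(F)=\{\rho_F(v):v\text{ terminal}\}$. $\mathrm{supp}(F)$ is the set of leaves of the trees of $F$ different from $\ast$. Define $\mathsf{For}_n=\{F\in\mathsf{For}:\mathrm{supp}(F)\subset[n]\}$, $\mathsf{LTFor}_n=\{F\in\mathsf{For}:\mathrm{LTer}(F)\subset[n]\}$ (which contains $\mathsf{For}_n$), $\mathsf{ZigZag}_n=\{F\in\mathsf{For}:\mathrm{LTer}(F)\subset\{n\}\}$. The product $F\cdot G$ is obtained by identifying, for each $i$, the $i$-th leaf of $F$ with the root of the $i$-th tree of $G$. Let $\tau(F)$ be the forest $(\ast,T_1,T_2,\ldots)$ for $F=(T_1,T_2,\ldots)$, and $\tau^{-1}$ its partial inverse. For $G\in\mathsf{ZigZag}_n$ and $H\in\mathsf{For}_n$, $G\star H:=(\tau^{-|H|}G)\cdot H$ if $G=\varnothing$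 or $\min\mathrm{supp}\,G>|H|$; otherwise $G\star H$ does not exist. Forest polynomials: let $\mathcal{C}(F)$ be the set of $\kappa:\mathrm{IN}(F)\to\mathbb{N}$ such that for all $v\in \mathrm{IN}(F)$: $\kappa(v)\le\rho_F(v)$; if $v_L\in \mathrm{IN}(F)$ then $\kappa(v)\le\kappa(v_L)$; if $v_R\in \mathrm{IN}(F)$ then $\kappa(v)<\kappa(v_R)$. Then $\mathfrak{P}_F=\sum_{\kappa\in\mathcal{C}(F)}\prod_{v\in \mathrm{IN}(F)}x_{\kappa(v)}$. $\mathcal{I}^{\star}_{k,n}\subset\mathrm{Pol}_n$ is the $\mathbb{Z}$-span of $\{\mathfrak{P}_{G\star H}: G\in\mathsf{ZigZag}_n,\ H\in\mathsf{For}_n,\ G\star H\text{ exists},\ |G|\ge k\}$. *)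

(* Defs.v *)
From HB Require Import structures.
From mathcomp Require Import all_boot all_order all_algebra.
From mathcomp Require Import boolp.
From mathcomp Require Import finmap mpoly.

Set Implicit Arguments.
Unset Strict Implicit.
Unset Printing Implicit Defensive.

Import GRing.Theory.
Local Open Scope fset_scope.
Local Open Scope ring_scope.
Local Open Scope quotient_scope.

(* All positions are counted from 0: the variable x_i, the leaf i and the tree *)
(* T_i of the usual 1-based conventions are 'X_(i-1), the leaf i-1 and the     *)
(* tree F (i-1) here. In particular [n] = {1, ..., n} becomes {0, ..., n-1},   *)
(* and inequalities between a position and a cardinality shift by one.         *)

(* -------------------------------------------------------------------------- *)

Definition zspan (V : zmodType) (S : V -> Prop) (v : V) : Prop :=
  exists (m : nat) (c : 'I_m -> int) (f : 'I_m -> V),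
    (forall i, S (f i)) /\ v = \sum_(i < m) f i *~ c i.

Definition zfree (V : zmodType) (I : eqType) (D : pred I) (b : I -> V) : Prop :=
  forall (s : seq I) (c : I -> int), uniq s -> all D s ->
    \sum_(i <- s) b i *~ c i = 0 -> {in s, forall i, c i = 0}.

(* The family (b i), for i in D, is a basis of the subgroup M of V. *)
Definition zbasis (V : zmodType) (M : V -> Prop)
    (I : eqType) (D : pred I) (b : I -> V) : Prop :=
  (forall v, M v <-> zspan (fun u => exists2 i, D i & u = b i) v) /\ zfree D b.

Definition zrank (V : zmodType) (r : nat) : Prop :=
  exists b : 'I_r -> V, zbasis (fun=> True) predT b.

Definition ideal_gen (R : comNzRingType) (S : R -> Prop) (p : R) : Prop :=
  exists (m : nat) (g f : 'I_m -> R),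
    (forall i, S (f i)) /\ p = \sum_(i < m) g i * f i.

(* -------------------------------------------------------------------------- *)

Section QuasiSymmetric.

Variable n : nat.

Definition qsym (p : {mpoly int[n]}) : Prop :=
  forall (k : nat) (a : 'I_k -> nat) (i j : 'I_k -> 'I_n),
    (forall t, 0 < a t)%N ->
    {homo i : s t / (s < t)%N} -> {homo j : s t / (s < t)%N} ->
    p@_(\sum_(t < k) U_(i t) *+ a t)%MM = p@_(\sum_(t < k) U_(j t) *+ a t)%MM.

Definition qsym_plus : {mpoly int[n]} -> Prop :=
  ideal_gen (fun f => qsym f /\ f@_0%MM = 0).

Definition qsym_ideal (k : nat) : {mpoly int[n]} -> Prop :=
  ideal_gen (fun f => qsym f /\ exists2 d, (k <= d)%N & f \is d.-homog).

Definition in_qsym_plus (p : {mpoly int[n]}) : bool := `[< qsym_plus p >].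

Lemma in_qsym_plus_idealr : idealr_closed in_qsym_plus.
Proof.
split.
- apply/asboolP; exists 0%N, (fun=> 0), (fun=> 0); split; first by case.
  by rewrite big_ord0.
- apply/asboolP => -[m [g [f [Hf E]]]].
  have /(congr1 (fun p : {mpoly int[n]} => p@_0%MM)) := E.
  rewrite mcoeff1 eqxx raddf_sum big1 //= => i _.
  have [_ f0] := Hf i.
  by rewrite (rmorphM (mcoeff 0%MM)) /= f0 mulr0.
- move=> a u v /asboolP [m [g [f [Hf ->]]]] /asboolP [m' [g' [f' [Hf' ->]]]].
  apply/asboolP; exists (m + m')%N.
  exists (fun i => match split i with inl j => a * g j | inr j => g' j end).
  exists (fun i => match split i with inl j => f j | inr j => f' j end).
  split; first by move=> i; case: (split i).
  rewrite big_split_ord /= mulr_sumr; congr (_ + _); apply: eq_bigr => i _.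
    by rewrite (unsplitK (inl i)) mulrA.
  by rewrite (unsplitK (inr i)).
Qed.

HB.instance Definition _ :=
  isIdealr.Build {mpoly int[n]} in_qsym_plus in_qsym_plus_idealr.

Definition qscoinv :=
  {ideal_quot (Idealr.clone {mpoly int[n]} in_qsym_plus _)}.

HB.instance Definition _ := GRing.ComNzRing.on qscoinv.
HB.instance Definition _ := EqQuotient.on qscoinv.

End QuasiSymmetric.

(* -------------------------------------------------------------------------- *)

Inductive btree := Leaf | Node of btree & btree.

Fixpoint btree_encode (t : btree) : GenTree.tree unit :=
  match t with
  | Leaf => GenTree.Leaf tt
  | Node l r => GenTree.Node 0 [:: btree_encode l; btree_encode r]
  end.

Fixpoint btree_decode (t : GenTree.tree unit) : btree :=
  match t with
  | GenTree.Node _ [:: l; r] => Node (btree_decode l) (btree_decode r)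
  | _ => Leaf
  end.

Lemma btree_encodeK : cancel btree_encode btree_decode.
Proof. by elim=> //= l -> r ->. Qed.

HB.instance Definition _ := Countable.copy btree (can_type btree_encodeK).

Fixpoint nleaves (t : btree) : nat :=
  if t is Node l r then (nleaves l + nleaves r)%N else 1%N.

(* A node of a tree is the path to it from the root, false standing for left   *)
(* and true for right; inodes lists the internal nodes.                        *)
Fixpoint inodes (t : btree) : seq (seq bool) :=
  if t is Node l r then
    [::] :: map (cons false) (inodes l) ++ map (cons true) (inodes r)
  else [::].

(* The leftmost leaf below the node p of t, given as the number of leaves of t *)
(* that lie to the left of the subtree at p.                                   *)
Fixpoint leftmost (t : btree) (p : seq bool) : nat :=
  match t, p with
  | Node l r, false :: q => leftmost l q
  | Node l r, true :: q => (nleaves l + leftmost r q)%N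
  | _, _ => 0%N
  end.

(* The leaf j of t is replaced with g j. *)
Fixpoint graft (t : btree) (g : nat -> btree) : btree :=
  if t is Node l r then
    Node (graft l g) (graft r (fun j => g (nleaves l + j)%N))
  else g 0%N.

(* -------------------------------------------------------------------------- *)

Definition forest := {fsfun nat -> btree with Leaf}.

Definition forest0 : forest := [fsfun].

Implicit Types F G H : forest.

Definition offset F (i : nat) : nat := (\sum_(j < i) nleaves (F j))%N.

(* Node (i, p) of F is the node p of the tree F i. *)
Definition node : Type := (nat * seq bool)%type.

Definition IN F : {fset node} :=
  [fset v in [seq (i, p) | i <- finsupp F, p <- inodes (F i)]].

Definition child (b : bool) (v : node) : node := (v.1, rcons v.2 b).

Definition rho F (v : node) : nat := (offset F v.1 + leftmost (F v.1) v.2)%N.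

Definition terminal F (v : node) : bool :=
  (child false v \notin IN F) && (child true v \notin IN F).

Definition LTer F : seq nat := [seq rho F v | v <- IN F & terminal F v].

Definition supp F : seq nat :=
  flatten [seq iota (offset F i) (nleaves (F i)) | i <- finsupp F].

Definition For (n : nat) : pred forest :=
  fun F => all (fun l => l < n)%N (supp F).

Definition LTFor (n : nat) : pred forest :=
  fun F => all (fun l => l < n)%N (LTer F).

Definition ZigZag (n : nat) : pred forest :=
  fun F => all (fun l => l.+1 == n) (LTer F).

Definition fbound F : nat := (\max_(i <- finsupp F) i.+1)%N.

(* The finite domain is large enough for fmulE below to hold everywhere. *)
Definition fmul F G : forest :=
  [fsfun i in [fset j in iota 0 (maxn (fbound F) (fbound G))] =>
     graft (F i) (fun j => G (offset F i + j)%N)].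

Definition tau F : forest :=
  [fsfun i in [fset j in iota 0 (fbound F).+1] =>
     if i is j.+1 then F j else Leaf].

(* tau^-m, only meaningful if the first m trees of F are trivial: see tauVK. *)
Definition tauV (m : nat) F : forest :=
  [fsfun i in [fset j in iota 0 (fbound F)] => F (m + i)%N].

(* With leaves counted from 0, min (supp G) > |H| reads |H| <= min (supp G). *)
Definition star G H : option forest :=
  if (G == forest0) || all (fun l => #|` IN H| <= l)%N (supp G)
  then Some (fmul (tauV #|` IN H| G) H) else None.

(* -------------------------------------------------------------------------- *)

Definition compatible F (kappa : IN F -> nat) : bool :=
  [forall v : IN F,
    [&& (kappa v <= rho F (val v))%N,
        [forall w : IN F,
          (val w == child false (val v)) ==> (kappa v <= kappa w)%N]
      & [forall w : IN F,
          (val w == child true (val v)) ==> (kappa v < kappa w)%N]]].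

(* Labels are restricted to the n variables at hand. For F in LTFor n, which   *)
(* is the only case used, this is no restriction: see compatible_lt and        *)
(* star_LTFor below.                                                           *)
Definition forest_poly (n : nat) F : {mpoly int[n]} :=
  \sum_(kappa : {ffun IN F -> 'I_n} | compatible (fun v => kappa v))
    \prod_(v : IN F) 'X_(kappa v).

Definition star_ideal (k n : nat) : {mpoly int[n]} -> Prop :=
  zspan (fun p => exists G H F,
    [/\ ZigZag n G, For n H, star G H = Some F, (k <= #|` IN G|)%N
      & p = forest_poly n F]).

Definition catalan (n : nat) : nat := ('C(n.*2, n) %/ n.+1)%N.

(* -------------------------------------------------------------------------- *)

Lemma in_IN F (v : node) : (v \in IN F) = (v.2 \in inodes (F v.1)).
Proof.
case: v => i p; rewrite !inE /=.
apply/allpairsPdep/idP => [[j [q [_ Hq [-> ->]]]] //|Hp].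
exists i, p; split=> //; rewrite mem_finsupp.
by apply: contraTneq Hp => ->.
Qed.

Lemma fboundP F i : (fbound F <= i)%N -> F i = Leaf.
Proof.
move=> le_i; apply/fsfun_dflt/negP => iF.
have := @leq_bigmax_seq nat (finsupp F : seq nat) predT succn i iF isT.
by rewrite leqNgt ltnS le_i.
Qed.

Lemma nleaves_gt0 t : (0 < nleaves t)%N.
Proof. by elim: t => //= l lt0 r _; rewrite addn_gt0 lt0. Qed.

Lemma offset_ge F i : (i <= offset F i)%N.
Proof.
rewrite /offset -{1}[i]card_ord -sum1_card leq_sum // => j _.
exact: nleaves_gt0.
Qed.

Lemma fmulE F G i : fmul F G i = graft (F i) (fun j => G (offset F i + j)%N).
Proof.
rewrite fsfunE !inE mem_iota /= add0n; case: ltnP => //; rewrite geq_max.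
case/andP=> leF leG; rewrite fboundP //= addn0 fboundP //.
exact: leq_trans leG (offset_ge F i).
Qed.

Lemma tauE F i : tau F i = if i is j.+1 then F j else Leaf.
Proof.
rewrite fsfunE in_fset [in_mem _ _](mem_iota 0 _.+1) add0n leq0n /=.
case: ltnP => //; by case: i => //= i le_i; rewrite fboundP.
Qed.

Lemma tauVE m F i : tauV m F i = F (m + i)%N.
Proof.
rewrite fsfunE !inE mem_iota /= add0n; case: ltnP => // le_i.
by rewrite fboundP // (leq_trans le_i) // leq_addl.
Qed.

Lemma offsetS F i : offset F i.+1 = (offset F i + nleaves (F i))%N.
Proof. by rewrite /offset big_ord_recr. Qed.

Lemma supp_trivial m F :
  all (fun l => m <= l)%N (supp F) -> forall i, (i < m)%N -> F i = Leaf.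
Proof.
move=> /allP Hm; elim/ltn_ind=> i IH lt_i; apply/eqP/negPn/negP => Fi.
suff : (m <= i)%N by rewrite leqNgt lt_i.
have -> : i = offset F i.
  rewrite /offset (eq_bigr (fun=> 1%N)) ?sum1_card ?card_ord // => j _.
  by rewrite IH // (ltn_trans (ltn_ord j)).
apply: Hm; apply/flattenP; exists (iota (offset F i) (nleaves (F i))).
  by apply/mapP; exists i => //; rewrite mem_finsupp.
by rewrite mem_iota leqnn -[ltnLHS]addn0 ltn_add2l nleaves_gt0.
Qed.

Lemma tauVK m F :
  all (fun l => m <= l)%N (supp F) -> iter m tau (tauV m F) = F.
Proof.
move=> /supp_trivial Hm; apply/fsfunP => i.
have itE k G j : iter k tau G j = if (j < k)%N then Leaf else G (j - k)%N.
  elim: k j => [|k IH] j; first by rewrite subn0.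
  by rewrite iterS tauE; case: j => //= j; rewrite IH ltnS subSS.
by rewrite itE; case: ltnP => [/Hm-> //|le_i]; rewrite tauVE subnKC.
Qed.

Lemma compatible_lt n F (kappa : IN F -> nat) :
  LTFor n F -> compatible kappa -> forall v, (kappa v < n)%N.
Proof.
move=> /allP ltF /forallP Hk.
have [M HM] : exists M, forall v : IN F, (size (val v).2 < M)%N.
  exists (\max_(v : IN F) size (val v).2).+1 => v.
  by rewrite ltnS (leq_bigmax v).
move=> v; have [d] := ubnP (M - size (val v).2)%N.
elim: d v => // d IH v; rewrite ltnS => le_d.
have /and3P[Hrho /forallP HL /forallP HR] := Hk v.
have step (w : IN F) b : val w = child b (val v) -> (kappa w < n)%N.
  move=> Ew; apply: IH; apply: leq_trans le_d.
  rewrite Ew size_rcons ltn_sub2l //; exact: HM.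
case: (boolP (child false (val v) \in IN F)) => [inL|ninL].
  apply: leq_ltn_trans (step [` inL] false erefl).
  by have /implyP -> := HL [` inL].
case: (boolP (child true (val v) \in IN F)) => [inR|ninR].
  apply: ltn_trans (step [` inR] true erefl).
  by have /implyP -> := HR [` inR].
apply: leq_ltn_trans Hrho _; apply/ltF/mapP; exists (val v) => //.
by rewrite mem_filter /terminal ninL ninR /=; apply: valP.
Qed.

Fixpoint ltert (t : btree) : seq nat :=
  match t with
  | Leaf => [::]
  | Node Leaf Leaf => [:: 0%N]
  | Node l r => ltert l ++ [seq (nleaves l + j)%N | j <- ltert r]
  end.

Lemma ltertE l r : ltert (Node l r) =
  if (l == Leaf) && (r == Leaf) then [:: 0%N]
  else ltert l ++ [seq (nleaves l + j)%N | j <- ltert r].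
Proof. by case: l => [|? ?]; case: r. Qed.

Lemma inodes_nil t : ([::] \in inodes t) = (t != Leaf).
Proof. by case: t. Qed.

Lemma inodes_cons l r b p :
  (b :: p \in inodes (Node l r)) = (p \in inodes (if b then r else l)).
Proof.
rewrite /= inE /= mem_cat; case: b.
  rewrite mem_map; last by move=> ? ? [].
  by case: mapP => [[? _ []]|].
rewrite orbC mem_map; last by move=> ? ? [].
by case: mapP => [[? _ []]|].
Qed.

Lemma ltertP t x : reflect
  (exists p, [/\ p \in inodes t, rcons p false \notin inodes t,
                 rcons p true \notin inodes t & x = leftmost t p])
  (x \in ltert t).
Proof.
apply: (iffP idP) => [|[p []]].
  elim: t x => // l IHl r IHr x; rewrite ltertE.
  case: ifP => [/andP[/eqP-> /eqP->]|_].
    by rewrite inE => /eqP->; exists [::].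
  rewrite mem_cat => /orP[/IHl [p [H1 H2 H3 ->]]|/mapP [y /IHr [p]]].
    by exists (false :: p); rewrite !rcons_cons !inodes_cons.
  move=> [H1 H2 H3 ->] ->; exists (true :: p).
  by rewrite !rcons_cons !inodes_cons.
elim: t p x => // l IHl r IHr [|b p] x.
  rewrite /rcons !inodes_cons !inodes_nil !negbK => _ /eqP-> /eqP-> ->.
  by rewrite inE.
rewrite !rcons_cons !inodes_cons => H1 H2 H3 ->; rewrite ltertE.
case: ifP => [/andP[/eqP El /eqP Er]|_].
  by move: H1; rewrite El Er; case: b {H2 H3}.
rewrite mem_cat; case: b H1 H2 H3 => H1 H2 H3.
  by apply/orP; right; apply/map_f/(IHr p).
by apply/orP; left; apply/(IHl p).
Qed.

Lemma LTerP F x : reflect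
  (exists i j, j \in ltert (F i) /\ x = (offset F i + j)%N) (x \in LTer F).
Proof.
apply: (iffP mapP) => [[[i p]]|[i [j [/ltertP [p [H1 H2 H3 ->]] ->]]]].
  rewrite mem_filter /terminal !in_IN /= => /andP[/andP[H2 H3] H1] ->.
  by exists i, (leftmost (F i) p); split=> //; apply/ltertP; exists p.
by exists (i, p) => //; rewrite mem_filter /terminal !in_IN /= H1 H2 H3.
Qed.

Lemma nleaves_graft t g :
  nleaves (graft t g) = (\sum_(j < nleaves t) nleaves (g j))%N.
Proof.
elim: t g => [|l IHl r IHr] g /=; first by rewrite big_ord1.
by rewrite IHl IHr big_split_ord.
Qed.

Lemma ltert_graft t g x : x \in ltert (graft t g) ->
  (exists i y, y \in ltert (g i) /\
     x = (\sum_(j < i) nleaves (g j) + y)%N) \/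
  (exists2 i, i \in ltert t & x = (\sum_(j < i) nleaves (g j))%N).
Proof.
elim: t g x => [|l IHl r IHr] g x.
  by rewrite /= => Hx; left; exists 0%N, x; rewrite big_ord0.
have graft_leaf t h : graft t h = Leaf -> t = Leaf by case: t.
rewrite [graft _ _]/= ltertE; case: ifP.
  case/andP=> /eqP /graft_leaf -> /eqP /graft_leaf ->.
  by rewrite inE => /eqP->; right; exists 0%N; rewrite ?inE ?big_ord0.
have mem_l i : i \in ltert l -> i \in ltert (Node l r).
  by rewrite ltertE; case: ifP => [/andP[/eqP-> _] //|_ Hi]; rewrite mem_cat Hi.
have mem_r i : i \in ltert r -> (nleaves l + i)%N \in ltert (Node l r).
  rewrite ltertE; case: ifP => [/andP[_ /eqP->] //|_ Hi].
  by rewrite mem_cat (map_f (addn _)) ?orbT.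
move=> _; rewrite mem_cat => /orP[/IHl [?|[i Hi Hx]]|].
- by left.
- by right; exists i => //; apply: mem_l.
case/mapP=> y /IHr H ->; rewrite nleaves_graft.
case: H => [[i [z [Hz ->]]]|[i Hi ->]].
  left; exists (nleaves l + i)%N, z; split=> //.
  by rewrite big_split_ord /= addnA.
by right; exists (nleaves l + i)%N; [apply: mem_r | rewrite big_split_ord].
Qed.

Lemma offsetD F i j :
  offset F (i + j) = (offset F i + \sum_(k < j) nleaves (F (i + k)%N))%N.
Proof. by rewrite /offset big_split_ord. Qed.

Lemma offset_fmul F G i : offset (fmul F G) i = offset G (offset F i).
Proof.
elim: i => [|i IH]; first by rewrite /offset !big_ord0.
by rewrite !offsetS IH fmulE nleaves_graft offsetD.
Qed.

Lemma LTer_fmul F G x : x \in LTer (fmul F G) ->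
  x \in LTer G \/ exists2 i, i \in LTer F & x = offset G i.
Proof.
case/LTerP=> i [y [+ ->]]; rewrite fmulE offset_fmul => /ltert_graft.
case=> [[k [z [Hz ->]]]|[k Hk ->]]; rewrite ?addnA -offsetD.
  by left; apply/LTerP; exists (offset F i + k)%N, z.
by right; exists (offset F i + k)%N => //; apply/LTerP; exists i, k.
Qed.

Lemma ltert_lt t x : x \in ltert t -> (x < nleaves t)%N.
Proof.
elim: t x => // l IHl r IHr x; rewrite ltertE; case: ifP => [_|_ /=].
  by rewrite inE => /eqP->; apply: nleaves_gt0.
rewrite mem_cat => /orP[/IHl lt_x|/mapP [y /IHr lt_y ->]].
  exact: ltn_addr.
by rewrite ltn_add2l.
Qed.

Lemma LTer_supp F : {subset LTer F <= supp F}.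
Proof.
move=> x /LTerP [i [y [Hy ->]]]; apply/flattenP.
exists (iota (offset F i) (nleaves (F i))).
  by apply/mapP; exists i; rewrite // mem_finsupp; apply: contraTneq Hy => ->.
by rewrite mem_iota leq_addr ltn_add2l ltert_lt.
Qed.

Lemma For_LTFor n F : For n F -> LTFor n F.
Proof. by move=> /allP HF; apply/allP => x /LTer_supp /HF. Qed.

Lemma size_inodes t : (size (inodes t)).+1 = nleaves t.
Proof.
by elim: t => //= l <- r <-; rewrite size_cat !size_map addSn addnS.
Qed.

Lemma inodes_uniq t : uniq (inodes t).
Proof.
elim: t => //= l IHl r IHr.
rewrite cat_uniq !map_inj_uniq ?IHl ?IHr; try by move=> ? ? [].
rewrite mem_cat negb_or andbT; apply/and3P; split=> //.
  by apply/andP; split; apply/mapP => -[].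
by apply/hasPn => _ /mapP [p _ ->]; apply/mapP => -[].
Qed.

Lemma card_IN_ge F m : (\sum_(i < m) size (inodes (F i)) <= #|` IN F|)%N.
Proof.
have -> : (\sum_(i < m) size (inodes (F i)) =
           size [seq (i, p) | i <- iota 0 m, p <- inodes (F i)])%N.
  rewrite size_allpairs_dep sumnE big_map.
  rewrite -(big_mkord xpredT (fun i => size (inodes (F i)))).
  by rewrite /index_iota subn0.
apply: uniq_leq_size.
  apply: allpairs_uniq_dep => [|i _|[i p] [j q] _ _ [-> ->]] //.
    exact: iota_uniq.
  exact: inodes_uniq.
by move=> _ /allpairsPdep [i [p [_ Hp ->]]]; rewrite in_IN.
Qed.

Lemma offset_le F i : (offset F i <= i + #|` IN F|)%N.
Proof.
apply: leq_trans (leq_add (leqnn i) (card_IN_ge F i)).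
have -> : (i + \sum_(j < i) size (inodes (F j)) =
           \sum_(j < i) (1 + size (inodes (F j))))%N.
  by rewrite big_split sum1_card card_ord.
by rewrite leq_sum // => j _; rewrite -size_inodes.
Qed.

Lemma star_LTFor n G H F :
  ZigZag n G -> For n H -> star G H = Some F -> LTFor n F.
Proof.
rewrite /star; set m := #|` IN H| => /allP ZG HH; case: ifP => // Hex [<-].
have suppG : all (fun l => m <= l)%N (supp G).
  case/orP: Hex => // /eqP ->; apply/allP => x /flattenP [s /mapP [i]].
  by rewrite mem_finsupp /forest0 fsfun0E eqxx.
apply/allP => x Hx; have {Hx} [Hx|[i Hi ->]] := LTer_fmul Hx.
  by have /allP -> := For_LTFor HH.
have HG : (m + i)%N \in LTer G.
  case/LTerP: Hi => j [y [Hy ->]]; rewrite tauVE in Hy.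
  apply/LTerP; exists (m + j)%N, y; split=> //; rewrite addnA; congr (_ + _)%N.
  rewrite offsetD; congr (_ + _)%N; last first.
    by apply: eq_bigr => k _; rewrite tauVE.
  rewrite /offset (eq_bigr (fun=> 1%N)) ?sum1_card ?card_ord // => k _.
  by rewrite (supp_trivial suppG).
apply: leq_ltn_trans (offset_le H i) _.
by rewrite addnC -(eqP (ZG _ HG)).
Qed.

(* Main.v *)
Require Import Defs.
From HB Require Import structures.
From mathcomp Require Import all_boot all_order all_algebra.
From mathcomp Require Import boolp.
From mathcomp Require Import finmap mpoly.
From mathcomp Require Import zify ring.

Set Implicit Arguments.
Unset Strict Implicit.
Unset Printing Implicit Defensive.

Import GRing.Theory.
Local Open Scope ring_scope.
Local Open Scope quotient_scope.

(** The proof rests on one family of operators. On polynomials in the variables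
    x_0, ..., x_(n-1), the substitution R_i ([zero_at i]) puts 0 for x_i and
    moves the later variables one place down, and the trimming operator T_i
    ([trim i]) is the divided difference (R_(i+1) f - R_i f) / x_i. It is well
    behaved on both sides of the theorem.

    On forest polynomials, T_i removes a terminal node: if F.i ([grow F i])
    is F with a terminal node added at leaf i, then T_i sends the polynomial
    of F.i to that of F ([trim_grow]), and it kills the polynomial of any
    forest without a terminal node at leaf i ([trim_notin]). So if a word w
    builds F from the empty forest, then trimming along w and taking the
    constant term extracts the coefficient of the polynomial of F
    ([mcoeff0_trim_word]). Moreover every polynomial is an integral
    combination of forest polynomials with F in LTFor_n
    ([forest_expansion]): a T_j-primitive made of forest polynomials can be
    subtracted until the last variable disappears.

    On quasisymmetric polynomials, g is quasisymmetric iff T_i g = 0 for all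
    i < n - 1 ([qsymP]). By the Leibniz rule T_i (f g) = (T_i f) (R_(i+1) g),
    so a word that builds a forest H of For_n acts on a product f g through f
    alone, up to setting the last |H| variables of g to 0
    ([trim_word_mul_qsym]).

    Every F in LTFor_n has the form G star H: trim F as long as some terminal
    node lies strictly left of the last available position ([LTFor_split]).
    If g is quasisymmetric of degree at least k and |G| < k, then the
    coefficient of the polynomial of G star H in f g is the constant term of
    |G| trimmings of a polynomial without terms of degree below k, hence 0
    ([qsym_ideal_vanish]). This is one inclusion. For the other one, expand
    the product of the polynomials of G and H: among the forests G' star H'
    with |H'| >= |H| only G star H occurs, with coefficient 1. The remaining
    terms have |H'| < |H| and, by the first inclusion, |G'| >= k, so an
    induction on |H| puts the polynomial of G star H in the ideal
    ([star_forest_ideal]).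

    For k = 1 the ideal is that of the quasisymmetric polynomials without
    constant term, the forests G star H with |G| >= 1 are those of LTFor_n
    outside For_n, and both bases follow by extracting coefficients. Finally
    For_n is in bijection with the binary trees with n + 1 leaves, by
    reading the left subtrees along the right spine of the tree; these are
    counted by the Catalan numbers. *)

(** * Adding a terminal node to a tree *)

Section GrowTree.
Implicit Types t l r : btree.

Definition tgrow t i := graft t (fun j => if j == i then Node Leaf Leaf else Leaf).

Lemma graft_eq t g h : (forall j, (j < nleaves t)%N -> g j = h j) ->
  graft t g = graft t h.
Proof.
elim: t g h => [|l IHl r IHr] g h E /=; first exact: E.
rewrite (IHl g h) ?(IHr (fun j => g _) (fun j => h (nleaves l + j)%N)) //.
  by move=> j Hj; apply: E; rewrite /= ltn_add2l.
by move=> j Hj; apply/E/ltn_addr.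
Qed.

Lemma graft_Leaf t : graft t (fun=> Leaf) = t.
Proof. by elim: t => //= l -> r ->. Qed.

Lemma tgrow_Nodel l r i : (i < nleaves l)%N ->
  tgrow (Node l r) i = Node (tgrow l i) r.
Proof.
move=> lt_i; rewrite /tgrow /=; congr Node.
rewrite -[RHS]graft_Leaf; apply: graft_eq => j _; case: eqP => // E; lia.
Qed.

Lemma tgrow_Noder l r i :
  tgrow (Node l r) (nleaves l + i) = Node l (tgrow r i).
Proof.
rewrite {1}/tgrow /=; congr Node; last first.
  by apply: graft_eq => j _; rewrite eqn_add2l.
rewrite -[RHS]graft_Leaf; apply: graft_eq => j Hj; case: eqP => // E; lia.
Qed.

Lemma nleaves_tgrow t i : nleaves (tgrow t i) = (nleaves t + (i < nleaves t))%N.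
Proof.
elim: t i => [|l IHl r IHr] i; first by case: i.
have [lt_i|le_i] := ltnP i (nleaves l).
  by rewrite tgrow_Nodel //= IHl lt_i ltn_addr // addnAC.
by rewrite -(subnKC le_i) tgrow_Noder /= IHr ltn_add2l addnA.
Qed.

Lemma tgrow_neq0 t i : (i < nleaves t)%N -> tgrow t i != Leaf.
Proof.
move=> lt_i; apply/eqP => E; have := nleaves_tgrow t i.
by rewrite E lt_i /=; have := nleaves_gt0 t; lia.
Qed.

End GrowTree.

(** * Sums over labelings of a tree with flagged leaves *)

Section FlaggedTrees.
Variable A : comNzRingType.
Implicit Types (x : nat -> A) (U V : nat -> nat).

(** The labels of the internal nodes are summed over as in a forest polynomial,
    except that the bound on the label of a node is prescribed by an arbitrary
    function U of its leftmost leaf (exclusively, so that 0 allows no label),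
    and that b bounds the label of the root from below. Substitutions R_i change
    the bounds, hence this generality. *)
Fixpoint treesum x t U b : A :=
  if t is Node l r then
    \sum_(b <= k < U 0%N)
      x k * (treesum x l U k * treesum x r (fun j => U (nleaves l + j)%N) k.+1)
  else 1.

(** The values of the variables after 0 has been inserted at position i in the
    sequence x. *)
Definition shift i x k : A := if k == i then 0 else x (unbump i k).

Lemma eq_treesum x t U V b : (forall j, (j < nleaves t)%N -> U j = V j) ->
  treesum x t U b = treesum x t V b.
Proof.
elim: t U V b => //= l IHl r IHr U V b E.
rewrite (E 0%N) ?addn_gt0 ?nleaves_gt0 //; apply: eq_bigr => k _.
congr (_ * (_ * _)); first by apply: IHl => j Hj; apply/E/ltn_addr.
by apply: IHr => j Hj; apply: E; rewrite ltn_add2l.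
Qed.

(** A label k <> i is renamed to unbump i k. This renaming is strictly monotone
    and maps the labels other than i onto all labels. *)
Lemma sum_shift i x b u (g : nat -> A) :
  \sum_(b <= k < u) shift i x k * g k =
  \sum_(unbump i b <= k < unbump i u) x k * g (bump i k).
Proof.
have [le_ub|lt_bu] := leqP u b.
  rewrite !big_geq // /unbump; lia.
elim: u lt_bu => // u IH; rewrite ltnS leq_eqVlt => /orP[/eqP ->|lt_bu].
  rewrite big_nat1 /shift; case: eqP => [->|ne].
    by rewrite mul0r big_geq // /unbump; lia.
  have -> : unbump i u.+1 = (unbump i u).+1 by rewrite /unbump; lia.
  rewrite big_nat1; congr (_ * g _); rewrite /bump /unbump; lia.
rewrite big_nat_recr ?IH //=; last exact: ltnW.
rewrite /shift; case: eqP => [->|ne].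
  rewrite mul0r addr0; have -> // : unbump i i.+1 = unbump i i.
  by rewrite /unbump; lia.
have -> : unbump i u.+1 = (unbump i u).+1 by rewrite /unbump; lia.
rewrite big_nat_recr /=; last by rewrite /unbump; lia.
congr (_ + _ * g _); rewrite /bump /unbump; lia.
Qed.

(** Strict monotonicity of the renaming preserves the inequalities along left
    and right edges alike, so only the bounds have to be renamed. *)
Lemma treesum_shift i x t U b :
  treesum (shift i x) t U b = treesum x t (unbump i \o U) (unbump i b).
Proof.
elim: t U b => //= l IHl r IHr U b; rewrite sum_shift.
apply: eq_bigr => k _; rewrite IHl IHr; congr (_ * (_ * _)).
  by congr treesum; rewrite /unbump /bump; lia.
by congr treesum; rewrite /unbump /bump; lia.
Qed.

Lemma treesum_empty x t U b : t != Leaf -> (U 0%N <= b)%N -> treesum x t U b = 0.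
Proof. by case: t => // l r _ le_b /=; rewrite big_geq. Qed.

(** The bounds of the leaves once the leaves j and j.+1 have been merged. *)
Definition skip i U j := U (bump i.+1 j).

Section Difference.
Variables (x : nat -> A) (c : nat).

(** The two systems of bounds agree except at leaf j, which may take the label c
    under U only. The last two conditions confine the effect of that label to
    the left branch ending at leaf j; they hold for the bounds that arise from
    two consecutive substitutions. *)
Definition flags_at j U V :=
  [/\ forall m, m != j -> V m = U m, V j = c, U j = c.+1,
      forall m, (m < j)%N -> (U m <= c)%N & (U j.+1 <= c.+1)%N].

Lemma flags_atr a j U V : flags_at (a + j)%N U V ->
  flags_at j (fun m => U (a + m)%N) (fun m => V (a + m)%N).
Proof.
case=> H1 H2 H3 H4 H5; split=> //; last by rewrite addnS.
  by move=> m ne; apply: H1; rewrite eqn_add2l.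
by move=> m lt_m; apply: H4; rewrite ltn_add2l.
Qed.

(** If leaf j is a right child, it bounds no label. Otherwise a labeling allowed
    by U but not by V gives the label c to the parent of leaf j. If that parent
    is not terminal, then leaf j.+1 bounds the label of its right child by c,
    whereas this label has to exceed c; so there is no such labeling. *)
Lemma treesum_notin t j U V b : flags_at j U V -> (b <= c)%N ->
  j \notin ltert t -> treesum x t U b = treesum x t V b.
Proof.
elim: t j U V b => // l IHl r IHr j U V b fl le_b.
rewrite ltertE; case: ifP => [/andP[/eqP-> /eqP->]|nLL].
  rewrite inE; case: fl => H1 _ _ _ _ nej /=.
  by rewrite !H1 // eq_sym.
rewrite mem_cat negb_or => /andP[nl nr] /=.
have [H1 H2 H3 H4 H5] := fl.
(* Leaf 0 lies below the root, which may then carry the label c itself; in the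
   other case the bound on the root is the same under U and V. *)
case: (posnP j) => [j0|j_gt0].
  subst j; have l_gt0 := nleaves_gt0 l.
  have Er k : treesum x r (fun m => U (nleaves l + m)%N) k =
              treesum x r (fun m => V (nleaves l + m)%N) k.
    by apply: eq_treesum => m _; rewrite H1 //; lia.
  rewrite H2 H3 big_nat_recr // /=.
  set z := x c * _; suff -> : z = 0.
    rewrite addr0; apply: eq_big_nat => k /andP[_ lt_k].
    by rewrite Er (IHl _ _ _ _ fl) // ltnW.
  rewrite /z; case: (eqVneq l Leaf) => [El|nl0].
    rewrite El eqxx /= in nLL.
    rewrite (treesum_empty _ (t := r)) ?mulr0 ?nLL //.
    by rewrite El addn0.
  rewrite (IHl _ _ _ _ fl) // (treesum_empty _ (t := l)) ?H2 //.
  by rewrite mul0r mulr0.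
rewrite H1 ?[_ == j]eq_sym -?lt0n //.
apply: eq_big_nat => k /andP[_ lt_k]; congr (_ * _).
have le_U := H4 _ j_gt0; have le_k : (k < c)%N by exact: leq_trans lt_k le_U.
have [lt_j|le_j] := ltnP j (nleaves l).
  rewrite (IHl _ _ _ _ fl) // ?(ltnW le_k) //; congr (_ * _).
  by apply: eq_treesum => m _; rewrite H1 //; lia.
rewrite -(subnKC le_j) in fl nr; congr (_ * _).
  by apply: eq_treesum => m lt_m; rewrite H1 //; lia.
apply: (IHr _ _ _ _ (flags_atr fl)) => //.
by move: nr; rewrite mem_map //; move=> ? ?; apply: addnI.
Qed.

(** The labelings allowed by U but not by V are those giving label c to the
    added terminal node. Removing that node divides the monomial by x c and
    leaves an arbitrary labeling of t, since c bounds the other labels on the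
    left branch anyway. *)
Lemma treesum_tgrow t j U V b : flags_at j U V -> (b <= c)%N ->
  (j < nleaves t)%N ->
  treesum x (tgrow t j) U b =
  treesum x (tgrow t j) V b + x c * treesum x t (skip j U) b.
Proof.
elim: t j U V b => [|l IHl r IHr] j U V b fl le_b lt_j.
  case: j fl lt_j => // -[_ H2 H3 _ _] _ /=.
  by rewrite H2 H3 big_nat_recr //= !mulr1.
have [H1 H2 H3 H4 H5] := fl.
have skip0 : skip j U 0%N = U 0%N by rewrite /skip /bump.
have le_U k : (0 < j)%N -> (k < U 0%N)%N -> (k < c)%N.
  by move=> j_gt0 /leq_trans; apply; apply: H4.
have [lt_jl|le_jl] := ltnP j (nleaves l); last first.
  rewrite -(subnKC le_jl) in fl *; set i := (j - nleaves l)%N in fl *.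
  have j_gt0 : (0 < j)%N by apply: leq_trans le_jl; apply: nleaves_gt0.
  rewrite tgrow_Noder /= -/(skip _ _ _) subnKC // skip0.
  rewrite (H1 0%N) 1?eq_sym -?lt0n // !big_distrr -big_split /=.
  apply: eq_big_nat => k /andP[_ lt_k].
  rewrite (IHr _ _ _ _ (flags_atr fl)); last 2 first.
  - exact: le_U.
  - by rewrite -(ltn_add2l (nleaves l)) /i subnKC.
  rewrite (eq_treesum _ _ (t := l) (V := V)); last first.
    by move=> m lt_m; rewrite H1 //; lia.
  rewrite (eq_treesum _ _ (t := l) (U := skip j U) (V := V)); last first.
    move=> m lt_m; rewrite /skip H1; first by congr U; rewrite /bump; lia.
    by apply/eqP; lia.
  have -> : treesum x r (fun m => skip j U (nleaves l + m)) k.+1 =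
            treesum x r (skip i (fun m => U (nleaves l + m)%N)) k.+1.
    apply: eq_treesum => m _; rewrite /skip; congr U.
    by rewrite /bump /i; lia.
  ring.
have Er k : treesum x r (fun m => skip j U (nleaves l + m)%N) k =
            treesum x r (fun m => U (nleaves (tgrow l j) + m)%N) k.
  apply: eq_treesum => m _; rewrite /skip; congr U.
  by rewrite nleaves_tgrow /bump; lia.
have ErV k : treesum x r (fun m => V (nleaves (tgrow l j) + m)%N) k =
            treesum x r (fun m => U (nleaves (tgrow l j) + m)%N) k.
  by apply: eq_treesum => m _; rewrite H1 // nleaves_tgrow; lia.
rewrite tgrow_Nodel //= skip0.
case: (posnP j) => [j0|j_gt0].
  subst j; rewrite H2 H3.
  rewrite big_distrr /= [X in X = _]big_nat_recr // [X in _ = _ + X]big_nat_recr //=.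
  rewrite addrA -big_split /=.
  rewrite (IHl _ _ _ _ fl) // (treesum_empty _ _ (t := tgrow l 0)) ?H2 ?tgrow_neq0 //.
  rewrite add0r !Er; congr (_ + _); last by ring.
  apply: eq_big_nat => k /andP[_ lt_k].
  by rewrite (IHl _ _ _ _ fl) // ?(ltnW lt_k) // ErV Er; ring.
rewrite (H1 0%N) 1?eq_sym -?lt0n // !big_distrr -big_split /=.
apply: eq_big_nat => k /andP[_ lt_k].
rewrite (IHl _ _ _ _ fl) // ?ErV ?Er; first by ring.
exact/ltnW/le_U.
Qed.

End Difference.

(** Labels weakly increase from the root to the terminal nodes, and the latter
    have labels below n. *)
Lemma treesum_vanish x t U b n : (forall j, j \in ltert t -> (U j <= n)%N) ->
  t != Leaf -> (n <= b)%N -> treesum x t U b = 0.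
Proof.
elim: t U b => // l IHl r IHr U b; rewrite ltertE => HU _ le_b /=.
case: ifP HU => [/andP[/eqP-> /eqP->] HU|nLL HU].
  by rewrite big_geq // (leq_trans (HU 0%N _)) ?inE.
rewrite big_nat_cond big1 // => k /andP[/andP[le_k _] _].
have le_nk := leq_trans le_b le_k.
case: (eqVneq l Leaf) => [El|nl].
  rewrite [X in _ * (_ * X)]IHr ?mulr0 //; last 2 first.
  - by move: nLL; rewrite El eqxx /= => ->.
  - exact: leqW.
  by move=> j Hj; apply: HU; rewrite mem_cat map_f ?orbT.
rewrite [X in _ * (X * _)]IHl ?mul0r ?mulr0 //.
by move=> j Hj; apply: HU; rewrite mem_cat Hj.
Qed.

(** Here the terminal nodes alone bound all labels: this is why a forest of
    LTFor_n, whose support may reach beyond n, has its polynomial in n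
    variables. *)
Lemma treesum_local x y t U b n : (forall j, j \in ltert t -> (U j <= n)%N) ->
  (forall k, (k < n)%N -> x k = y k) -> treesum x t U b = treesum y t U b.
Proof.
move=> + E; elim: t U b => // l IHl r IHr U b; rewrite ltertE => HU /=.
apply: eq_big_nat => k /andP[_ lt_k].
case: ifP HU => [/andP[/eqP-> /eqP->] HU|nLL HU].
  by rewrite E // (leq_trans lt_k) // HU // inE.
have HUl j : j \in ltert l -> (U j <= n)%N.
  by move=> Hj; apply: HU; rewrite mem_cat Hj.
have HUr j : j \in ltert r -> (U (nleaves l + j) <= n)%N.
  by move=> Hj; apply: HU; rewrite mem_cat map_f ?orbT.
have [/E ->|le_k] := ltnP k n; first by rewrite IHl ?IHr.
case: (eqVneq l Leaf) => [El|nl].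
  have nr : r != Leaf by move: nLL; rewrite El eqxx /= => ->.
  by rewrite !(treesum_vanish _ (t := r) (n := n)) ?mulr0 ?leqW.
by rewrite !(treesum_vanish _ (t := l) (n := n)) ?mul0r ?mulr0.
Qed.

End FlaggedTrees.

(** * Forests: leaves, products and terminal nodes *)

Implicit Types F G H : forest.

Lemma forest0E k : forest0 k = Leaf.
Proof. by rewrite /forest0 fsfun0E. Qed.

Lemma offset0 F : offset F 0 = 0%N.
Proof. by rewrite /offset big_ord0. Qed.

Lemma offset_lt F k l : (k < l)%N -> (offset F k < offset F l)%N.
Proof.
elim: l => // l IH; rewrite ltnS leq_eqVlt offsetS => /orP[/eqP->|/IH lt_k].
  by rewrite -[ltnLHS]addn0 ltn_add2l nleaves_gt0.
exact: ltn_addr.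
Qed.

Lemma offset_mono F k l : (k <= l)%N -> (offset F k <= offset F l)%N.
Proof. by rewrite leq_eqVlt => /orP[/eqP->//|/(offset_lt F)/ltnW]. Qed.

Lemma leafP F i : exists k j, (j < nleaves (F k))%N /\ i = (offset F k + j)%N.
Proof.
have: exists k, (i < offset F k)%N by exists i.+1; apply: offset_ge.
move=> ex; case: (ex_minnP ex) => -[|k]; first by rewrite offset0.
rewrite offsetS => lt_i min_k; exists k, (i - offset F k)%N.
have le_i : (offset F k <= i)%N by rewrite leqNgt; apply/negP => /min_k; rewrite ltnn.
by rewrite subnKC // -(ltn_add2l (offset F k)) subnKC.
Qed.

Lemma graftA t g h :
  graft (graft t g) h =
  graft t (fun j => graft (g j) (fun m => h (\sum_(i < j) nleaves (g i) + m)%N)).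
Proof.
elim: t g h => [|l IHl r IHr] g h /=.
  by apply: graft_eq => j _; rewrite big_ord0.
rewrite IHl IHr; congr Node; apply: graft_eq => j _; apply: graft_eq => m _.
by rewrite nleaves_graft big_split_ord /= addnA.
Qed.

Lemma fmulA F G H : fmul F (fmul G H) = fmul (fmul F G) H.
Proof.
apply/fsfunP => k; rewrite !fmulE graftA offset_fmul.
apply: graft_eq => j _; rewrite fmulE; apply: graft_eq => m _.
by rewrite addnA offsetD.
Qed.

Lemma fmulF0 F : fmul F forest0 = F.
Proof.
apply/fsfunP => k; rewrite fmulE -[RHS]graft_Leaf.
by apply: graft_eq => j _; rewrite forest0E.
Qed.

Definition cherry i : forest := [fsfun forest0 with i |-> Node Leaf Leaf].

Lemma cherryE i k : cherry i k = if k == i then Node Leaf Leaf else Leaf.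
Proof. by rewrite fsfun_withE forest0E. Qed.

Lemma offset_cherry i k : offset (cherry i) k = (k + (i < k))%N.
Proof.
elim: k => [|k IH]; first by rewrite offset0.
by rewrite offsetS IH cherryE; case: eqP => [->|ne] /=; lia.
Qed.

Definition grow F i := fmul F (cherry i).

Lemma offset_grow F i k : offset (grow F i) k = (offset F k + (i < offset F k))%N.
Proof. by rewrite offset_fmul offset_cherry. Qed.

Lemma grow_at F k j : grow F (offset F k + j) k = tgrow (F k) j.
Proof.
by rewrite fmulE; apply: graft_eq => m _; rewrite cherryE eqn_add2l.
Qed.

Lemma grow_out F i k : (i < offset F k)%N || (offset F k.+1 <= i)%N ->
  grow F i k = F k.
Proof.
move=> out; rewrite fmulE -[RHS]graft_Leaf; apply: graft_eq => m lt_m.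
rewrite cherryE; case: eqP => // E.
by move: out; rewrite -E offsetS leq_add2l [(nleaves _ <= _)%N]leqNgt lt_m; lia.
Qed.

Lemma grow_at_neq F k j l : (j < nleaves (F k))%N -> l != k ->
  grow F (offset F k + j) l = F l.
Proof.
move=> lt_j; rewrite neq_ltn => /orP[lt_l|lt_k]; apply: grow_out.
  have := offset_mono F lt_l; lia.
by have := offset_mono F lt_k; rewrite offsetS; lia.
Qed.

Lemma ltert_tgrow t i : (i < nleaves t)%N -> i \in ltert (tgrow t i).
Proof.
elim: t i => [|l IHl r IHr] i; first by case: i.
have [lt_i _|le_i] := ltnP i (nleaves l).
  rewrite tgrow_Nodel // ltertE (negbTE (tgrow_neq0 lt_i)) /=.
  by rewrite mem_cat IHl.
rewrite -(subnKC le_i) tgrow_Noder /= ltn_add2l => lt_i.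
rewrite -/(ltert (Node _ _)) ltertE (negbTE (tgrow_neq0 lt_i)) andbF.
by rewrite mem_cat map_f ?orbT ?IHr.
Qed.

Lemma ltert_tgrow_gt t i j : (i < j)%N -> j \in ltert t ->
  j.+1 \in ltert (tgrow t i).
Proof.
elim: t i j => // l IHl r IHr i j lt_ij.
rewrite ltertE; case: ifP => [_|nLL].
  by rewrite inE => /eqP j0; move: lt_ij; rewrite j0.
have [lt_i|le_i] := ltnP i (nleaves l).
  rewrite tgrow_Nodel // ltertE (negbTE (tgrow_neq0 lt_i)) /= !mem_cat.
  case/orP=> [/IHl -> //|/mapP [m Hm ->]]; apply/orP; right.
  apply/mapP; exists m => //; rewrite nleaves_tgrow lt_i; lia.
have [i' Ei] : exists i', i = (nleaves l + i')%N by exists (i - nleaves l)%N; lia.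
subst i; rewrite tgrow_Noder ltertE mem_cat => /orP[/ltert_lt|/mapP [m Hm Em]].
  by lia.
have lt_i : (i' < nleaves r)%N by have := ltert_lt Hm; lia.
rewrite (negbTE (tgrow_neq0 lt_i)) andbF mem_cat; apply/orP; right.
apply/mapP; exists m.+1; last by rewrite Em addnS.
by apply: IHr => //; lia.
Qed.

Lemma ltert_ungrow t j : j \in ltert t ->
  exists2 t', t = tgrow t' j & (j < nleaves t')%N.
Proof.
elim: t j => // l IHl r IHr j; rewrite ltertE.
case: ifP => [/andP[/eqP-> /eqP->]|_]; first by rewrite inE => /eqP->; exists Leaf.
rewrite mem_cat => /orP[/IHl [l' -> lt_j]|/mapP [m /IHr [r' -> lt_m] ->]].
  by exists (Node l' r); rewrite ?tgrow_Nodel //= ltn_addr.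
by exists (Node l r'); rewrite ?tgrow_Noder //= ltn_add2l.
Qed.

Lemma LTer_ungrow F i : i \in LTer F -> exists F', F = grow F' i.
Proof.
case/LTerP=> k [j [Hj ->]].
have [t' Et lt_j] := ltert_ungrow Hj.
pose F' : forest := [fsfun F with k |-> t'].
have F'E l : l != k -> F' l = F l by rewrite fsfun_withE => /negbTE ->.
have F'k : F' k = t' by rewrite fsfun_with.
have offF' l : (l <= k)%N -> offset F' l = offset F l.
  move=> le_l; apply: eq_bigr => m _; rewrite F'E //.
  by have := ltn_ord m; lia.
exists F'; apply/fsfunP => l; rewrite -offF' //.
case: (eqVneq l k) => [->|ne]; first by rewrite grow_at F'k.
by rewrite grow_at_neq ?F'k // F'E.
Qed.

Lemma LTer_grow F i : i \in LTer (grow F i).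
Proof.
have [k [j [lt_j ->]]] := leafP F i; apply/LTerP; exists k, j.
rewrite grow_at ltert_tgrow // offset_grow; split=> //; lia.
Qed.

Lemma LTer_grow_gt F i j : (i < j)%N -> j \in LTer F -> j.+1 \in LTer (grow F i).
Proof.
move=> lt_ij /LTerP [k [m [Hm Ej]]]; apply/LTerP; exists k.
have [lt_i|le_i] := ltnP i (offset F k).
  by exists m; rewrite grow_out ?lt_i // offset_grow lt_i addn1 addSn -Ej.
have lt_m := ltert_lt Hm.
have [i' Ei] : exists i', i = (offset F k + i')%N by exists (i - offset F k)%N; lia.
subst i; exists m.+1; rewrite grow_at ltert_tgrow_gt //; last by lia.
by rewrite offset_grow; split=> //; lia.
Qed.

Lemma LTer_grow_sub F i x : x \in LTer (grow F i) ->
  x = i \/ exists2 j, j \in LTer F & x = (j + (i < j))%N.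
Proof.
case/LTer_fmul=> [/LTerP [k [j [+ ->]]]|[j Hj ->]]; last first.
  by right; exists j => //; apply: offset_cherry.
rewrite cherryE; case: eqP => // -> /=; rewrite inE => /eqP->.
by left; rewrite offset_cherry; lia.
Qed.

(** If all terminal nodes lie weakly left of i, none is pushed right. *)
Lemma LTFor_grow F i : LTFor i.+1 F -> LTFor i.+1 (grow F i).
Proof.
move=> /allP HF; apply/allP => x /LTer_grow_sub [->//|[j /HF lt_j ->]]; lia.
Qed.

Lemma LTFor_ungrow m F i : LTFor m (grow F i) -> (i < m)%N /\ LTFor m F.
Proof.
move=> /allP HF; have lt_i := HF _ (LTer_grow F i); split=> //.
apply/allP => j Hj; have [|lt_ij] := leqP j i; first by lia.
by have := HF _ (LTer_grow_gt lt_ij Hj); lia.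
Qed.

Lemma LTFor_ungrow_pred m F i : LTFor m (grow F i) -> (i.+1 < m)%N -> LTFor m.-1 F.
Proof.
move=> /allP HF lt_i; apply/allP => j Hj; have [|lt_ij] := leqP j i; first by lia.
by have := HF _ (LTer_grow_gt lt_ij Hj); lia.
Qed.

Lemma ltert_neq0 t : t != Leaf -> exists j, j \in ltert t.
Proof.
elim: t => // l IHl r IHr _; rewrite ltertE.
case: ifP => [_|]; first by exists 0%N; rewrite inE.
case: (eqVneq l Leaf) => [-> /= /negbT /IHr [j Hj]|/IHl [j Hj] _].
  by exists (1 + j)%N; apply: map_f.
by exists j; rewrite mem_cat Hj.
Qed.

Lemma LTer_neq0 F : F != forest0 -> exists i, i \in LTer F.
Proof.
move=> /eqP F0; have : exists k, F k != Leaf.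
  apply: contrapT => H; apply: F0; apply/fsfunP => k; rewrite forest0E.
  by apply/eqP/negP => /negP Hk; apply: H; exists k.
by case=> k /ltert_neq0 [j Hj]; exists (offset F k + j)%N; apply/LTerP; exists k, j.
Qed.

(** * Counting internal nodes, and supports *)

(** A tree with m internal nodes has m.+1 leaves, so beyond all nontrivial trees
    the number of leaves exceeds the number of trees by the number of internal
    nodes. *)
Lemma offset_card F N : (fbound F <= N)%N -> offset F N = (N + #|` IN F|)%N.
Proof.
move=> leN; apply/eqP; rewrite eqn_leq offset_le /=.
have -> : offset F N = (N + \sum_(j < N) size (inodes (F j)))%N.
  rewrite -[X in (X + _)%N]card_ord -sum1_card -big_split /=.
  by apply: eq_bigr => j _; rewrite -size_inodes.
rewrite leq_add2l.
have -> : (\sum_(i < N) size (inodes (F i)) =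
           size [seq (i, p) | i <- iota 0 N, p <- inodes (F i)])%N.
  rewrite size_allpairs_dep sumnE big_map.
  rewrite -(big_mkord xpredT (fun i => size (inodes (F i)))).
  by rewrite /index_iota subn0.
apply: uniq_leq_size => [|[k p]]; first exact: fset_uniq.
rewrite in_IN /= => Hp.
apply/allpairsPdep; exists k, p; split=> //; rewrite mem_iota /= add0n.
by rewrite ltnNge; apply: contraL Hp => /(leq_trans leN)/fboundP ->.
Qed.

Lemma card_grow F i : #|` IN (grow F i)| = #|` IN F|.+1.
Proof.
pose N := (i.+1 + (fbound F + fbound (grow F i)))%N.
have := @offset_card (grow F i) N; rewrite offset_grow.
have := @offset_card F N; have := offset_ge F N; rewrite /N; lia.
Qed.

Lemma card_IN_eq0 F : (#|` IN F| == 0)%N = (F == forest0).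
Proof.
apply/eqP/eqP => [|->].
  by case: (eqVneq F forest0) => // /LTer_neq0 [i /LTer_ungrow [F' ->]]; rewrite card_grow.
by apply/eqP; rewrite cardfs_eq0; apply/eqP/fsetP => v; rewrite in_IN forest0E.
Qed.

Lemma card_IN0 : #|` IN forest0| = 0%N.
Proof. by apply/eqP; rewrite card_IN_eq0. Qed.

(** Only the rightmost leaf of each nontrivial tree matters. *)
Lemma ForP n F : reflect (forall k, F k != Leaf -> (offset F k.+1 <= n)%N) (For n F).
Proof.
apply: (iffP allP) => H.
  move=> k Fk; rewrite offsetS -(prednK (nleaves_gt0 (F k))) addnS.
  apply: H; apply/flattenP; exists (iota (offset F k) (nleaves (F k))).
    by apply/mapP; exists k => //; rewrite mem_finsupp.
  by rewrite mem_iota; have := nleaves_gt0 (F k); lia.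
move=> l /flattenP [s /mapP [k]]; rewrite mem_finsupp => /H le_n -> .
by rewrite mem_iota -offsetS => /andP[_ /leq_trans]; apply.
Qed.

Lemma For0 n : For n forest0.
Proof. by apply/ForP => k; rewrite forest0E. Qed.

Lemma For_grow m F i : For m F -> (i < m)%N -> For m.+1 (grow F i).
Proof.
move=> /ForP HF lt_i; apply/ForP => k nk; rewrite offset_grow.
case: (eqVneq (F k) Leaf) => [Fk|/HF]; last by lia.
have : (offset F k <= i < offset F k.+1)%N.
  rewrite !ltnNge -!ltnNge; apply: contraR nk; rewrite negb_and -ltnNge -leqNgt => out.
  by rewrite grow_out // Fk.
by rewrite offsetS Fk /=; lia.
Qed.

Lemma For_ungrow m F i : For m (grow F i) -> (i.+1 < m)%N /\ For m.-1 F.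
Proof.
move=> /ForP HF; have [k [j [lt_j Ei]]] := leafP F i.
have lt_i : (i < offset F k.+1)%N by rewrite offsetS Ei ltn_add2l.
have lt_im : (i.+1 < m)%N.
  have := HF k; rewrite offset_grow lt_i Ei grow_at => /(_ (tgrow_neq0 lt_j)).
  by move: lt_i; rewrite Ei; lia.
split=> //; apply/ForP => l Fl; have [lt_il|] := ltnP i (offset F l.+1); last by lia.
suff /HF : grow F i l != Leaf by rewrite offset_grow lt_il; lia.
case: (eqVneq l k) => [->|ne]; first by rewrite Ei grow_at tgrow_neq0.
by rewrite Ei grow_at_neq.
Qed.

(** * Building forests by words *)

(** The last letter acts first, so that the head of the word is the first
    terminal node to be trimmed. *)
Definition grow_word F w := foldr (fun i F' => grow F' i) F w.

(** Trimming at i a forest supported on m leaves makes sense when i.+1 is one of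
    them, and leaves a forest supported on m.-1 leaves. These words build the
    forests of For_m. *)
Fixpoint admissible m w := if w is i :: w' then (i.+1 < m)%N && admissible m.-1 w' else true.

Lemma grow_word_cat F u w : grow_word F (u ++ w) = grow_word (grow_word F w) u.
Proof. by rewrite /grow_word foldr_cat. Qed.

Lemma grow_word_fmul F w : grow_word F w = fmul F (grow_word forest0 w).
Proof. by elim: w => [|i w IH] /=; rewrite ?fmulF0 // IH /grow fmulA. Qed.

Lemma card_grow_word F w : #|` IN (grow_word F w)| = (#|` IN F| + size w)%N.
Proof. by elim: w => [|i w IH] /=; rewrite ?addn0 // card_grow IH addnS. Qed.

Lemma LTFor_grow_word m F w : LTFor m (grow_word F w) -> all (fun i => i < m)%N w /\ LTFor m F.
Proof.
by elim: w => //= i w IH /LTFor_ungrow [-> /IH].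
Qed.

Lemma LTFor_word m F : LTFor m F -> exists2 w, F = grow_word forest0 w & all (fun i => i < m)%N w.
Proof.
have [d] := ubnP #|` IN F|; elim: d F => // d IH F le_d HF.
case: (eqVneq F forest0) => [->|/LTer_neq0 [i /LTer_ungrow [F' E]]].
  by exists [::].
subst F; rewrite card_grow in le_d; have [lt_i HF'] := LTFor_ungrow HF.
by have [//|w -> Hw] := IH F' _ HF'; exists (i :: w) => //=; rewrite lt_i.
Qed.

Lemma admissible_lt m w : admissible m w -> all (fun i => i < m)%N w.
Proof.
elim: w m => //= i w IH m /andP[lt_i /IH /allP Hw]; rewrite (ltnW lt_i) /=.
by apply/allP => j /Hw; lia.
Qed.

Lemma admissible_size m w : (0 < m)%N -> admissible m w -> (size w < m)%N.
Proof. by elim: w m => //= i w IH m m_gt0 /andP[lt_i /IH]; lia. Qed.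

Lemma For_word m F : For m F -> exists2 w, F = grow_word forest0 w & admissible m w.
Proof.
have [d] := ubnP #|` IN F|; elim: d F m => // d IH F m le_d HF.
case: (eqVneq F forest0) => [->|/LTer_neq0 [i /LTer_ungrow [F' E]]].
  by exists [::].
subst F; rewrite card_grow in le_d; have [lt_i HF'] := For_ungrow HF.
by have [//|w -> Hw] := IH F' _ _ HF'; exists (i :: w) => //=; rewrite lt_i.
Qed.

Lemma For_grow_word m w : admissible m w -> For m (grow_word forest0 w).
Proof.
elim: w m => [|i w IH] m /=; first by rewrite For0.
case/andP=> lt_i /IH HF; rewrite -(ltn_predK lt_i); apply: For_grow => //; lia.
Qed.

(** Trim a terminal node as long as one lies strictly left of the last position,
    which moves down by one at each step. This is the decomposition of F as a
    star product, with the shift of the zigzag factor undone. *)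
Lemma LTFor_split m F : (0 < m)%N -> LTFor m F -> exists G w,
  [/\ F = grow_word G w, admissible m w & all (fun l => l.+1 == m - size w)%N (LTer G)].
Proof.
have [d] := ubnP #|` IN F|; elim: d F m => // d IH F m le_d m_gt0 HF.
have [Hm|] := boolP (all (fun l => l.+1 == m)%N (LTer F)).
  by exists F, [::]; rewrite subn0.
case/allPn=> i iF ne; have lt_i : (i.+1 < m)%N.
  by have /allP/(_ _ iF) := HF; lia.
have [F' E] := LTer_ungrow iF.
subst F; rewrite card_grow in le_d.
have [//||G [w [-> Hw HG]]] := IH F' m.-1 _ _ (LTFor_ungrow_pred HF lt_i).
  by lia.
exists G, (i :: w); split=> //=; first by rewrite lt_i.
by have -> : (m - (size w).+1 = m.-1 - size w)%N by lia.
Qed.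

(** * Shifts and the star product *)

Lemma iter_tauE s F k : iter s tau F k = if (k < s)%N then Leaf else F (k - s)%N.
Proof.
elim: s k => [|s IH] k; first by rewrite subn0.
by rewrite iterS tauE; case: k => //= k; rewrite IH ltnS subSS.
Qed.

Lemma offset_iter_tau s F k : offset (iter s tau F) (s + k) = (s + offset F k)%N.
Proof.
rewrite offsetD; congr (_ + _)%N; last first.
  by apply: eq_bigr => j _; rewrite iter_tauE ltnNge leq_addr addKn.
by rewrite /offset (eq_bigr (fun=> 1%N)) ?sum1_card ?card_ord // => j _; rewrite iter_tauE ltn_ord.
Qed.

Lemma LTer_iter_tau s F x :
  x \in LTer (iter s tau F) -> exists2 y, y \in LTer F & x = (s + y)%N.
Proof.
case/LTerP=> k [j []]; rewrite iter_tauE; case: ltnP => // le_s Hj ->.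
exists (offset F (k - s) + j)%N; first by apply/LTerP; exists (k - s)%N, j.
by rewrite -{1}(subnKC le_s) offset_iter_tau addnA.
Qed.

Lemma LTer_iter_tau_mem s F y : y \in LTer F -> (s + y)%N \in LTer (iter s tau F).
Proof.
case/LTerP=> k [j [Hj ->]]; apply/LTerP; exists (s + k)%N, j.
by rewrite iter_tauE ltnNge leq_addr addKn offset_iter_tau addnA.
Qed.

Lemma card_iter_tau s F : #|` IN (iter s tau F)| = #|` IN F|.
Proof.
pose N := (fbound F + fbound (iter s tau F))%N.
have := @offset_card (iter s tau F) (s + N); rewrite offset_iter_tau.
by have := @offset_card F N; rewrite /N; lia.
Qed.

Lemma star_iter_tau s G H : #|` IN H| = s -> star (iter s tau G) H = Some (fmul G H).
Proof.
rewrite /star => ->; rewrite ifT; last first.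
  apply/orP; right; apply/allP => l /flattenP [r /mapP [k]].
  rewrite mem_finsupp iter_tauE; case: ltnP; rewrite ?eqxx // => le_s _ ->.
  by rewrite mem_iota => /andP[+ _]; apply/leq_trans/(leq_trans le_s)/offset_ge.
congr (Some (fmul _ _)); apply/fsfunP => k.
by rewrite tauVE iter_tauE ltnNge leq_addr addKn.
Qed.

Lemma starP G H F : star G H = Some F ->
  exists2 G', G = iter #|` IN H| tau G' & F = fmul G' H.
Proof.
rewrite /star; case: ifP => // Hex [<-]; exists (tauV #|` IN H| G) => //.
rewrite tauVK //; case/orP: Hex => // /eqP ->.
by apply/allP => l /flattenP [r /mapP [k]]; rewrite mem_finsupp forest0E eqxx.
Qed.

(** * Forest polynomials as products over trees *)

(** A total sequence of variables; the value 0 beyond n removes the labels that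
    are not available. *)
Definition xvar n k : {mpoly int[n]} := if insub k is Some i then 'X_i else 0.

Lemma xvarE n (i : 'I_n) : xvar n i = 'X_i.
Proof. by rewrite /xvar valK. Qed.

Lemma xvar_ge n k : (n <= k)%N -> xvar n k = 0.
Proof. by move=> le_n; rewrite /xvar insubF // ltnNge le_n. Qed.

Definition forestsum (A : comNzRingType) (x : nat -> A) (U : nat -> nat) (F : forest) : A :=
  \prod_(k < fbound F) treesum x (F k) (fun j => U (offset F k + j)%N) 0.

Lemma forestsum_widen (A : comNzRingType) (x : nat -> A) U F N : (fbound F <= N)%N ->
  forestsum x U F = \prod_(k < N) treesum x (F k) (fun j => U (offset F k + j)%N) 0.
Proof.
move=> leN; rewrite /forestsum -(subnKC leN) big_split_ord /=.
rewrite [X in _ = _ * X]big1 ?mulr1 // => j _.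
by rewrite fboundP //= leq_addr.
Qed.

Lemma sum_ord_nat (V : nmodType) (f : nat -> V) n b u :
  (forall k, (n <= k)%N -> f k = 0) ->
  \sum_(k < n) (if (b <= k < u)%N then f k else 0) = \sum_(b <= k < u) f k.
Proof.
move=> f0; rewrite -(big_mkord xpredT (fun k => if (b <= k < u)%N then f k else 0)).
rewrite -big_mkcond (big_nat_widen _ _ _ _ _ (leq_addr u n)).
rewrite [RHS]big_geq_mkord -(big_mkord (fun k => b <= k)%N).
rewrite (big_nat_widen _ _ _ _ _ (leq_addl n u)) big_mkcond [RHS]big_mkcond /=.
apply: eq_bigr => k _; case: (b <= k)%N; case: (k < u)%N => //=.
by case: ltnP => // /f0.
Qed.

Section LabelSum.
Variables (n : nat) (A : comNzRingType).

Section Generic.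
Local Open Scope fset_scope.
Local Open Scope ring_scope.
Variable T : choiceType.
Implicit Types (K : {fset T}) (s : seq T) (kappa : T -> nat) (Phi : (T -> nat) -> A).

Definition upd kappa v k : T -> nat := fun u => if u == v then k else kappa u.

(** An iterated sum over the labels of the nodes listed in s, one node after the
    other. It replaces the sum over functions on a finite set of nodes, and it
    splits along the recursive structure of trees. *)
Fixpoint labelsum s kappa Phi : A :=
  if s is v :: s' then \sum_(k < n) labelsum s' (upd kappa v k) Phi else Phi kappa.

(** Labelings are handled as functions on all nodes, so that they can be
    restricted to subtrees by composition with a path. *)
Definition extend K (kappa : {ffun K -> 'I_n}) : T -> nat :=
  fun v => if insub v is Some u then val (kappa u) else 0%N.

Lemma extendE K (kappa : {ffun K -> 'I_n}) (v : K) : extend kappa (val v) = kappa v.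
Proof. by rewrite /extend valK. Qed.

Lemma extend_upd K (kappa : {ffun K -> 'I_n}) (v : K) k :
  extend [ffun u => if u == v then k else kappa u] = upd (extend kappa) (val v) k.
Proof.
apply: funext => u; rewrite /upd /extend; case: insubP => [w _ <-|].
  by rewrite ffunE (inj_eq val_inj); case: eqP.
by case: eqP => // -> /negP; case; apply: valP.
Qed.

(** Fix the labels outside s, and sort the functions by the label of the head of
    s. *)
Lemma labelsum_ffun_from K s (kappa0 : {ffun K -> 'I_n}) Phi :
  uniq s -> {subset s <= K} ->
  \sum_(kappa : {ffun K -> 'I_n} |
      [forall v : K, (val v \notin s) ==> (kappa v == kappa0 v)]) Phi (extend kappa)
  = labelsum s (extend kappa0) Phi.
Proof.
elim: s kappa0 => [|v s IH] kappa0 /=.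
  move=> _ _; rewrite (big_pred1 kappa0) // => kappa.
  apply/forallP/eqP => [H|-> v]; last exact: eqxx.
  by apply/ffunP => v; have /eqP := H v.
case/andP=> vs us sub; have vK : v \in K by apply: sub; rewrite inE eqxx.
rewrite (partition_big (fun kappa : {ffun K -> 'I_n} => kappa [` vK]) predT) //=.
apply: eq_bigr => k _.
rewrite -(extend_upd kappa0 [` vK]) -IH //; last first.
  by move=> u us'; apply: sub; rewrite inE us' orbT.
apply: eq_bigl => kappa; apply/andP/forallP => [[/forallP H /eqP Hk] u|H].
  apply/implyP => us'; rewrite ffunE.
  case: (eqVneq u [` vK]) => [->|ne]; first by rewrite Hk.
  have := H u; rewrite inE negb_or us' andbT.
  by rewrite -[v]/(val [` vK]) (inj_eq val_inj) ne.
split; last by have := H [` vK]; rewrite /= vs ffunE eqxx.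
apply/forallP => u; apply/implyP; rewrite inE negb_or => /andP[ne us'].
have := H u; rewrite us' ffunE; case: (eqVneq u [` vK]) => // E.
by move: ne; rewrite E eqxx.
Qed.

Lemma labelsum_ffun K s Phi : (0 < n)%N -> uniq s -> s =i K ->
  \sum_(kappa : {ffun K -> 'I_n}) Phi (extend kappa) = labelsum s (fun=> 0%N) Phi.
Proof.
move=> n_gt0 us sK; pose kappa0 : {ffun K -> 'I_n} := [ffun=> Ordinal n_gt0].
have <- : extend kappa0 = fun=> 0%N.
  by apply: funext => v; rewrite /extend; case: insubP => // u _ _; rewrite ffunE.
rewrite -labelsum_ffun_from //; last by move=> v; rewrite sK.
apply: eq_bigl => kappa; apply/esym/forallP => v.
by rewrite sK (valP v).
Qed.

Lemma eq_labelsum s kappa Phi Psi :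
  (forall kappa', {in [predC s], kappa' =1 kappa} -> Phi kappa' = Psi kappa') ->
  labelsum s kappa Phi = labelsum s kappa Psi.
Proof.
elim: s kappa => [|v s IH] kappa H /=; first exact: H.
apply: eq_bigr => k _; apply: IH => kappa' E; apply: H => u.
rewrite !inE negb_or => /andP[ne us]; rewrite E ?inE // /upd.
by rewrite (negbTE ne).
Qed.

Lemma labelsum_ext s (D : pred T) kappa kappa' Phi :
  (forall k1 k2, {in D, k1 =1 k2} -> Phi k1 = Phi k2) ->
  {in D, kappa =1 kappa'} -> labelsum s kappa Phi = labelsum s kappa' Phi.
Proof.
move=> HPhi; elim: s kappa kappa' => [|v s IH] kappa kappa' E /=; first exact: HPhi.
by apply: eq_bigr => k _; apply: IH => u Du; rewrite /upd E.
Qed.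

Lemma labelsumZ s kappa a Phi :
  labelsum s kappa (fun k => a * Phi k) = a * labelsum s kappa Phi.
Proof.
elim: s kappa => //= v s IH kappa.
by rewrite mulr_sumr; apply: eq_bigr => k _; apply: IH.
Qed.

End Generic.

Variable x : nat -> A.
Hypothesis x_ge : forall k, (n <= k)%N -> x k = 0.

(** Compatibility of a labeling, following the recursion of treesum. *)
Fixpoint tcompat t (U : nat -> nat) b (kappa : seq bool -> nat) : bool :=
  if t is Node l r then
    [&& (b <= kappa [::] < U 0%N)%N,
        tcompat l U (kappa [::]) (kappa \o cons false)
      & tcompat r (fun j => U (nleaves l + j)%N) (kappa [::]).+1 (kappa \o cons true)]
  else true.

Definition weight t U b kappa : A :=
  if tcompat t U b kappa then \prod_(p <- inodes t) x (kappa p) else 0.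

Lemma weight_Node l r U b kappa : weight (Node l r) U b kappa =
  (if (b <= kappa [::] < U 0%N)%N then x (kappa [::]) else 0) *
  (weight l U (kappa [::]) (kappa \o cons false) *
   weight r (fun j => U (nleaves l + j)%N) (kappa [::]).+1 (kappa \o cons true)).
Proof.
rewrite /weight /=; case: ifP => [/and3P[-> -> ->]|].
  by rewrite big_cons big_cat !big_map.
do 3![case: ifP; rewrite ?mul0r ?mulr0 //=].
Qed.

Lemma eq_weight t U b (k1 k2 : seq bool -> nat) :
  {in inodes t, k1 =1 k2} -> weight t U b k1 = weight t U b k2.
Proof.
elim: t U b k1 k2 => [|l IHl r IHr] U b k1 k2 E.
  by rewrite /weight !big_nil.
have E0 : k1 [::] = k2 [::] by apply: E; rewrite inodes_nil.
rewrite !weight_Node E0; congr (_ * (_ * _)).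
  by apply: IHl => p Hp; apply: E; rewrite inodes_cons.
by apply: IHr => p Hp; apply: E; rewrite inodes_cons.
Qed.

(** The nodes of the tree come first in the iterated sum. The factor Psi is read
    on the nodes of D, which these steps leave alone, so the sum over the tree
    factors out. *)
Lemma labelsum_tree (T : choiceType) t U b (f : seq bool -> T) s (D : pred T) kappa Psi :
  injective f -> {in inodes t, forall p, f p \notin D /\ f p \notin s} ->
  (forall k1 k2, {in D, k1 =1 k2} -> Psi k1 = Psi k2) ->
  labelsum (map f (inodes t) ++ s) kappa (fun k => weight t U b (k \o f) * Psi k)
  = treesum x t U b * labelsum s kappa Psi.
Proof.
elim: t U b f s D kappa Psi => [|l IHl r IHr] U b f s D kappa Psi injf Hf HPsi.
  rewrite /= mul1r; apply: eq_labelsum => k _.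
  by rewrite /weight /= big_nil mul1r.
have f0 := Hf [::]; rewrite inodes_nil in f0; have [//|f0D f0s] := f0.
have injfb c : injective (f \o cons c) by move=> p q /injf [].
have Hfb c p : p \in inodes (if c then r else l) -> f (c :: p) \notin D /\ f (c :: p) \notin s.
  by move=> Hp; apply: Hf; rewrite inodes_cons.
have step (k : nat) :
  labelsum (map f (map (cons false) (inodes l) ++ map (cons true) (inodes r)) ++ s)
     (upd kappa (f [::]) k) (fun k => weight (Node l r) U b (k \o f) * Psi k) =
  (if (b <= k < U 0%N)%N then x k * (treesum x l U k *
       treesum x r (fun j => U (nleaves l + j)%N) k.+1) else 0)
  * labelsum s kappa Psi.
  pose Psi' kap := weight r (fun j => U (nleaves l + j)%N) k.+1 (kap \o (f \o cons true)) * Psi kap.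
  pose c := (if (b <= k < U 0%N)%N then x k else 0).
  transitivity (labelsum (map (f \o cons false) (inodes l) ++
                  (map (f \o cons true) (inodes r) ++ s)) (upd kappa (f [::]) k)
     (fun kap => c * (weight l U k (kap \o (f \o cons false)) * Psi' kap))).
    rewrite map_cat -!map_comp -catA; apply: eq_labelsum => kap E.
    have E0 : kap (f [::]) = k.
      rewrite E /upd ?eqxx // inE /= !mem_cat !negb_or f0s andbT.
      by apply/andP; split; apply/mapP => -[p _ /injf].
    by rewrite weight_Node /= E0 /Psi' -!mulrA.
  rewrite labelsumZ.
  rewrite (IHl _ _ _ _ [pred v | (v \in D) || (v \in map (f \o cons true) (inodes r))]) //.
  - rewrite (IHr _ _ _ _ D) //; last by move=> p /(Hfb true).
    rewrite (labelsum_ext (D := D) _ (kappa' := kappa)) //.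
      by rewrite /c; case: ifP => _; rewrite ?mul0r // !mulrA.
    move=> v Dv; rewrite /upd; case: eqP => // Ev.
    by move: f0D; rewrite -Ev -topredE /= => /negP.
  - move=> p Hp; have [nD ns] := Hfb false p Hp.
    rewrite inE negb_or nD mem_cat negb_or ns andbT.
    suff -> : (f \o cons false) p \notin [seq (f \o cons true) i | i <- inodes r] by [].
    by apply/mapP => -[q _ /injf].
  move=> k1 k2 E; rewrite /Psi'; congr (_ * _).
    by apply: eq_weight => p Hp /=; apply: E; rewrite inE (map_f (f \o cons true)) ?orbT.
  by apply: HPsi => v Dv; apply: E; rewrite inE Dv.
rewrite [inodes _]/= map_cons cat_cons /=.
rewrite (eq_bigr _ (fun (k : 'I_n) _ => step k)) -mulr_suml; congr (_ * _).
by apply: sum_ord_nat => k /x_ge ->; rewrite mul0r.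
Qed.

End LabelSum.

(** The recursive condition unfolds into one condition for each node and its
    children, which is the shape of compatible. *)
Lemma tcompatP t U b kappa : reflect
  [/\ t != Leaf -> (b <= kappa [::])%N
    & forall p, p \in inodes t ->
      [/\ (kappa p < U (leftmost t p))%N,
          rcons p false \in inodes t -> (kappa p <= kappa (rcons p false))%N
        & rcons p true \in inodes t -> (kappa p < kappa (rcons p true))%N]]
  (tcompat t U b kappa).
Proof.
elim: t U b kappa => [|l IHl r IHr] U b kappa; first by apply: (iffP idP).
apply: (iffP and3P) => [[/andP[Hb HU] /IHl [Hl Cl] /IHr [Hr Cr]]|[Hb C]].
  split=> // -[|[] p].
  - by rewrite /rcons !inodes_cons !inodes_nil.
  - by rewrite !rcons_cons !inodes_cons => /Cr.
  by rewrite !rcons_cons !inodes_cons => /Cl.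
have [//|HU Cl Cr] := C [::]; split.
- by rewrite Hb.
- apply/IHl; split=> [nl|p Hp]; first by apply: Cl; rewrite inodes_cons inodes_nil.
  by have := C (false :: p); rewrite !rcons_cons !inodes_cons => /(_ Hp).
apply/IHr; split=> [nl|p Hp]; first by apply: Cr; rewrite inodes_cons inodes_nil.
by have := C (true :: p); rewrite !rcons_cons !inodes_cons => /(_ Hp).
Qed.

Lemma labelsum_forest n (F : forest) (U : nat -> nat -> nat) ks kappa : uniq ks ->
  labelsum n (flatten [seq [seq (k, p) | p <- inodes (F k)] | k <- ks]) kappa
    (fun kap => \prod_(k <- ks) weight (xvar n) (F k) (U k) 0 (kap \o pair k))
  = \prod_(k <- ks) treesum (xvar n) (F k) (U k) 0.
Proof.
elim: ks kappa => [|k ks IH] kappa; first by rewrite /= !big_nil.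
case/andP=> kks uks; rewrite map_cons big_cons -(IH kappa) //.
rewrite -(@labelsum_tree _ _ _ _ _ _ _ _ (pair k) _ [pred v : node | v.1 \in ks]).
- by apply: eq_labelsum => kap _; rewrite big_cons.
- by move=> k' kn; rewrite xvar_ge.
- by move=> p q [].
- move=> p _; rewrite inE /= kks; split=> //.
  by apply/flattenP => -[_ /mapP [j jks ->] /mapP [q _ [E _]]]; rewrite E jks in kks.
move=> k1 k2 E; apply: eq_big_seq => j jks; apply: eq_weight => p _.
by apply: E.
Qed.

(** There are no conditions between distinct trees, so the sum over labelings of
    the forest is the product of the sums over labelings of its trees. *)
Lemma forest_polyE n (F : forest) : (0 < n)%N -> forest_poly n F = forestsum (xvar n) S F.
Proof.
move=> n_gt0; pose ks := iota 0 (fbound F).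
pose s := flatten [seq [seq (k, p) | p <- inodes (F k)] | k <- ks].
pose Phi (kap : node -> nat) := \prod_(k <- ks)
  weight (xvar n) (F k) (fun j => (offset F k + j).+1) 0 (kap \o pair k).
have us : uniq s.
  apply: allpairs_uniq_dep => [|k _|[k p] [j q] _ _ [-> ->]] //.
    exact: iota_uniq.
  exact: inodes_uniq.
have sIN : s =i IN F.
  case=> k p; rewrite in_IN /=; apply/allpairsPdep/idP => [[j [q [_ Hq [-> ->]]]] //|Hp].
  exists k, p; split=> //; rewrite mem_iota /= add0n ltnNge.
  by apply: contraL Hp => /fboundP ->.
transitivity (\sum_(kappa : {ffun IN F -> 'I_n}) Phi (extend kappa)); last first.
  rewrite (labelsum_ffun _ n_gt0 us sIN) labelsum_forest ?iota_uniq //.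
  rewrite /forestsum -(big_mkord xpredT
    (fun k : nat => treesum (xvar n) (F k) (fun j => (offset F k + j).+1) 0)).
  by rewrite /index_iota subn0.
rewrite /forest_poly big_mkcond; apply: eq_bigr => kappa _.
have ext (v : IN F) : extend kappa (val v) = kappa v by apply: extendE.
have compatE : compatible (fun v => kappa v) =
  all (fun k => tcompat (F k) (fun j => (offset F k + j).+1) 0 (extend kappa \o pair k)) ks.
  apply/forallP/allP => [H k _|H v].
    apply/tcompatP; split=> // p Hp.
    have inF : (k, p) \in IN F by rewrite in_IN.
    have /and3P[H1 /forallP H2 /forallP H3] := H (Sub (k, p) inF).
    rewrite /= -[(k, p)]/(val (Sub (k, p) inF : IN F)) ext; split=> [|Hc|Hc].
    - by rewrite ltnS.
    - have inc : (k, rcons p false) \in IN F by rewrite in_IN.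
      rewrite -[(k, rcons p false)]/(val (Sub (k, rcons p false) inc : IN F)) ext.
      exact: implyP (H2 (Sub (k, rcons p false) inc)) (eqxx _).
    have inc : (k, rcons p true) \in IN F by rewrite in_IN.
    rewrite -[(k, rcons p true)]/(val (Sub (k, rcons p true) inc : IN F)) ext.
    exact: implyP (H3 (Sub (k, rcons p true) inc)) (eqxx _).
  have vF : (val v).2 \in inodes (F (val v).1) by rewrite -in_IN; apply: valP.
  have vks : (val v).1 \in ks.
    rewrite mem_iota /= add0n ltnNge.
    by apply: contraL vF => /fboundP ->.
  have /tcompatP[_ /(_ _ vF) []] := H _ vks.
  rewrite /= -surjective_pairing ext ltnS => H1 H2 H3.
  rewrite -/(rho F (val v)) in H1; rewrite H1 /=.
  have extw w b : fsval w = child b (fsval v) -> kappa w = extend kappa (child b (fsval v)) :> nat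
      /\ rcons (fsval v).2 b \in inodes (F (fsval v).1).
    by move=> Ew; rewrite -ext -Ew; split=> //; have := fsvalP w; rewrite Ew in_IN.
  by apply/andP; split; apply/forallP => w; apply/implyP => /eqP /extw [-> Hc];
    [apply: H2 | apply: H3].
rewrite compatE; case: allP => [Hall|Hnall]; last first.
  suff [k kks nk] : exists2 k, k \in ks &
      ~~ tcompat (F k) (fun j => (offset F k + j).+1) 0 (extend kappa \o pair k).
    rewrite /Phi (perm_big _ (perm_to_rem kks)) big_cons.
    by rewrite {1}/weight (negbTE nk) /= mul0r.
  by apply/allPn/allP.
rewrite /Phi (eq_big_seq (fun k => \prod_(p <- inodes (F k)) xvar n (extend kappa (k, p)))).
  transitivity (\prod_(v <- s) xvar n (extend kappa v)).
    rewrite (perm_big (enum_fset (IN F))) /=; last first.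
      by apply: uniq_perm => //; apply: fset_uniq.
    rewrite big_seq_fsetE /=.
    by apply: eq_bigr => v _; rewrite ext xvarE.
  by rewrite /s big_flatten big_map; apply: eq_bigr => k _; rewrite big_map.
by move=> k kks; rewrite /weight Hall.
Qed.

(** * Substitutions and trimming operators *)

Section Operators.
Variable n : nat.
Local Notation Pol := {mpoly int[n]}.
Implicit Types f g : Pol.

Lemma mpoly_ring_ind (P : Pol -> Prop) :
  (forall c, P c%:MP) -> (forall i : 'I_n, P 'X_i) ->
  (forall f g, P f -> P g -> P (f + g)) -> (forall f g, P f -> P g -> P (f * g)) ->
  forall f, P f.
Proof.
move=> PC PX PD PM f; rewrite [f]mpolyE.
apply: (big_ind P _ PD) => [|m _]; first by rewrite -mpolyC0; apply: PC.
rewrite -mul_mpolyC; apply: (PM) => //; rewrite mpolyXE_id.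
apply: (big_ind P _ PM) => [|i _]; first by rewrite -mpolyC1; apply: PC.
by elim: (m i) => [|k IH]; rewrite ?exprS; [rewrite expr0 -mpolyC1; apply: PC | apply: (PM)].
Qed.

Definition zero_at_def i f : Pol := f \mPo [tuple shift i (xvar n) j | j < n].
Fact zero_at_key : unit. Proof. by []. Qed.
Definition zero_at := locked_with zero_at_key zero_at_def.

Lemma zero_atE i f : zero_at i f = f \mPo [tuple shift i (xvar n) j | j < n].
Proof. by rewrite /zero_at unlock. Qed.

Lemma zero_at_is_additive i : zmod_morphism (zero_at i).
Proof. by move=> f g; rewrite !zero_atE comp_mpolyB. Qed.

Lemma zero_at_is_multiplicative i : monoid_morphism (zero_at i).
Proof. by split=> [|f g]; rewrite !zero_atE ?comp_mpoly1 ?rmorphM. Qed.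

HB.instance Definition _ i :=
  GRing.isZmodMorphism.Build Pol Pol (zero_at i) (zero_at_is_additive i).
HB.instance Definition _ i :=
  GRing.isMonoidMorphism.Build Pol Pol (zero_at i) (zero_at_is_multiplicative i).

Lemma zero_atC i c : zero_at i c%:MP = c%:MP.
Proof. by rewrite zero_atE comp_mpolyC. Qed.

Lemma zero_atX i (j : 'I_n) : zero_at i 'X_j = shift i (xvar n) j.
Proof. by rewrite zero_atE comp_mpolyXU -tnth_nth tnth_mktuple. Qed.

Lemma zero_at_xvar i k : (k < n)%N -> zero_at i (xvar n k) = shift i (xvar n) k.
Proof. by move=> lt_k; rewrite -[k]/(val (Ordinal lt_k)) xvarE zero_atX. Qed.

Lemma zero_at_n f : zero_at n f = f.
Proof.
elim/mpoly_ring_ind: f => [c|i|f g Ef Eg|f g Ef Eg].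
- exact: zero_atC.
2,3: by rewrite ?rmorphD ?rmorphM /= Ef Eg.
rewrite zero_atX /shift; case: eqP => [E|_]; first by have := ltn_ord i; rewrite E ltnn.
by rewrite /unbump ltnNge ltnW // subn0 xvarE.
Qed.

(** Inserting 0 at two positions in either order. *)
Lemma zero_at_comm i j f : (i < j <= n)%N ->
  zero_at i (zero_at j f) = zero_at j.-1 (zero_at i f).
Proof.
case/andP=> lt_ij le_j.
elim/mpoly_ring_ind: f => [c|k|f g Ef Eg|f g Ef Eg].
- by rewrite !zero_atC.
2,3: by rewrite ?rmorphD ?rmorphM /= Ef Eg.
have lt_k := ltn_ord k; rewrite !zero_atX /shift.
have [Ej|nj] := eqVneq (k : nat) j.
  rewrite rmorph0 ifF; last by lia.
  rewrite zero_at_xvar; last by rewrite /unbump; lia.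
  by rewrite /shift ifT // /unbump; lia.
have [Ei|ni] := eqVneq (k : nat) i.
  rewrite rmorph0 zero_at_xvar; last by rewrite /unbump; lia.
  by rewrite /shift ifT // /unbump; lia.
rewrite !zero_at_xvar; try by rewrite /unbump; lia.
rewrite /shift; case: eqP => [|_]; first by rewrite /unbump; lia.
case: eqP => [|_]; first by rewrite /unbump; lia.
by congr xvar; rewrite /unbump; lia.
Qed.

Lemma xvar_neq0 i : (i < n)%N -> xvar n i != 0.
Proof.
move=> lt_i; rewrite -[i]/(val (Ordinal lt_i)) xvarE.
apply/eqP => /(congr1 (mcoeff U_(Ordinal lt_i)%MM)).
by rewrite mcoeffX eqxx mcoeff0.
Qed.

(** The set of polynomials f for which the difference is divisible by x_i is a
    subring that contains the variables. *)
Lemma trim_exists i f : (i < n)%N ->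
  exists q, xvar n i * q = zero_at i.+1 f - zero_at i f.
Proof.
move=> lt_i; elim/mpoly_ring_ind: f => [c|j|f g [q Hq] [r Hr]|f g [q Hq] [r Hr]].
- by exists 0; rewrite !zero_atC subrr mulr0.
- rewrite !zero_atX /shift; case: eqP => [E1|n1].
    exists (-1); rewrite E1 mulrN1 sub0r; case: eqP; first by lia.
    by rewrite /unbump ltnSn subn1.
  case: eqP => [E|n0].
    by exists 1; rewrite mulr1 subr0 E /unbump; congr xvar; lia.
  exists 0; rewrite mulr0; apply/eqP; rewrite eq_sym subr_eq0; apply/eqP.
  by congr xvar; rewrite /unbump; lia.
- by exists (q + r); rewrite mulrDr Hq Hr !rmorphD; ring.
exists (zero_at i.+1 f * r + q * zero_at i g).
rewrite mulrDr mulrCA Hr mulrA Hq !rmorphM; ring.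
Qed.

Definition trim i f : Pol :=
  if pselect (i < n)%N is left lt_i then projT1 (cid (trim_exists f lt_i)) else 0.

Lemma trimE i f : (i < n)%N -> xvar n i * trim i f = zero_at i.+1 f - zero_at i f.
Proof. by rewrite /trim => H; case: pselect => // lt_i; case: cid. Qed.

Lemma trim_uniq i f q : (i < n)%N ->
  xvar n i * q = zero_at i.+1 f - zero_at i f -> trim i f = q.
Proof. by move=> lt_i; rewrite -trimE // => /(mulfI (xvar_neq0 lt_i)). Qed.

Lemma trim_is_additive i : zmod_morphism (trim i).
Proof.
move=> f g; have [lt_i|le_n] := ltnP i n; last first.
  rewrite /trim; case: pselect => [lt_i|_]; last by rewrite subrr.
  by have := leq_trans lt_i le_n; rewrite ltnn.
by apply: trim_uniq => //; rewrite mulrBr !trimE // !rmorphB; ring.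
Qed.

HB.instance Definition _ i :=
  GRing.isZmodMorphism.Build Pol Pol (trim i) (trim_is_additive i).

Lemma trim_eq0 i f : (i < n)%N -> trim i f = 0 <-> zero_at i.+1 f = zero_at i f.
Proof.
move=> lt_i; split=> [E|E]; first by apply/eqP; rewrite -subr_eq0 -trimE // E mulr0.
by apply: trim_uniq => //; rewrite E subrr mulr0.
Qed.

(** The twisted Leibniz rule, for a second factor killed by T_i. *)
Lemma trimM i f g : (i < n)%N -> trim i g = 0 -> trim i (f * g) = trim i f * zero_at i.+1 g.
Proof.
move=> lt_i /(trim_eq0 _ lt_i) Eg; apply: trim_uniq => //.
by rewrite mulrA trimE // !rmorphM /= -Eg; ring.
Qed.

(** Equivalently, f only involves the variables before j: for such f, and only
    for them, inserting 0 at position j or later changes nothing. *)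
Definition depends_on j f := forall i, (j <= i <= n)%N -> zero_at i f = f.

(** R_n is the identity, and T_i f = 0 says that R_i and R_(i+1) agree on f;
    descend from n to j. *)
Lemma depends_onP j f : (j <= n)%N ->
  depends_on j f <-> (forall i, (j <= i < n)%N -> trim i f = 0).
Proof.
move=> le_j; split=> [Df i /andP[le_i lt_i]|Tf].
  by apply/trim_eq0 => //; rewrite !Df //; lia.
suff H d : forall i, (j <= i <= n)%N -> (n - i <= d)%N -> zero_at i f = f.
  by move=> i Hi; apply: (H n) => //; apply: leq_subr.
elim: d => [|d IH] i /andP[le_i le_n] le_d.
  by have -> : i = n by [lia]; apply: zero_at_n.
have [lt_i|?] := ltnP i n; last by have -> : i = n by [lia]; apply: zero_at_n.
have /(trim_eq0 _ lt_i) <- : trim i f = 0 by apply: Tf; lia.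
by apply: IH; lia.
Qed.

(** By commuting substitutions, x_j times T_j f is again fixed by the later
    substitutions. *)
Lemma depends_on_trim j f : (j < n)%N -> depends_on j.+1 f -> depends_on j.+1 (trim j f).
Proof.
move=> lt_j Df i /andP[lt_ji]; rewrite leq_eqVlt => /orP[/eqP->|lt_i].
  exact: zero_at_n.
apply: (mulfI (xvar_neq0 lt_j)).
have <- : zero_at i (xvar n j) = xvar n j.
  rewrite zero_at_xvar // /shift ifF; last by lia.
  by congr xvar; rewrite /unbump; lia.
rewrite -rmorphM trimE // rmorphB /=.
have Ei : zero_at i (zero_at j f) = zero_at j f.
  have := @zero_at_comm j i.+1 f; rewrite (Df i.+1) //=; last by lia.
  by move=> <- //; lia.
rewrite Ei zero_at_xvar // /shift ifF; last by lia.
have -> : xvar n (unbump i j) = xvar n j by congr xvar; rewrite /unbump; lia.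
by rewrite trimE // (Df j.+1) ?ltnSn // Df //; lia.
Qed.

(** Inserting n times 0 at position 0 kills all variables. *)
Lemma depends_on0 f : depends_on 0 f -> f = (f@_0)%:MP.
Proof.
move=> Df.
have xk k j : (j < n)%N ->
    iter k (zero_at 0) (xvar n j) = if (j < k)%N then 0 else xvar n (j - k).
  elim: k j => [|k IH] j lt_j; first by rewrite subn0.
  rewrite iterSr zero_at_xvar // /shift /unbump; case: eqP => [->|ne] /=.
    by elim: k {IH} => //= k ->; rewrite rmorph0.
  rewrite IH; last by lia.
  have -> : (j - (0 < j) < k)%N = (j < k.+1)%N by lia.
  by case: ltnP => // _; congr xvar; lia.
suff H : iter n (zero_at 0) f = (f@_0)%:MP by rewrite -H iter_fix // Df.
elim/mpoly_ring_ind: f {Df} => [c|j|f g|f g].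
- have -> : iter n (zero_at 0) c%:MP = c%:MP by apply: iter_fix; apply: zero_atC.
  by rewrite mcoeffC eqxx mulr1.
- by rewrite -xvarE xk ?ltn_ord // xvarE mcoeffX mnm1_eq0 mpolyC0.
- have -> N : iter N (zero_at 0) (f + g) = iter N (zero_at 0) f + iter N (zero_at 0) g.
    by elim: N => //= k ->; rewrite rmorphD.
  by rewrite mcoeffD mpolyCD => <- <-.
have -> N : iter N (zero_at 0) (f * g) = iter N (zero_at 0) f * iter N (zero_at 0) g.
  by elim: N => //= k ->; rewrite rmorphM.
by rewrite (rmorphM (mcoeff 0%MM)) mpolyCM => <- <-.
Qed.

Local Notation expo m k := (nth 0%N (m : 'X_{1..n}) k).

Definition del_at i (m : 'X_{1..n}) : 'X_{1..n} := [multinom expo m (bump i j) | j < n].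
Definition ins_at i (m : 'X_{1..n}) : 'X_{1..n} :=
  [multinom if j == i :> nat then 0%N else expo m (unbump i j) | j < n].

Lemma expo_ge (m : 'X_{1..n}) k : (n <= k)%N -> expo m k = 0%N.
Proof. by move=> le_n; rewrite nth_default // size_tuple. Qed.

Lemma expoE (m : 'X_{1..n}) (k : 'I_n) : m k = expo m k.
Proof. exact: mnm_nth. Qed.

Lemma expo_del i m k : (k < n)%N -> expo (del_at i m) k = expo m (bump i k).
Proof. by move=> lt_k; rewrite -[k]/(val (Ordinal lt_k)) -mnm_nth mnmE. Qed.

Lemma expo_ins i m k : (k < n)%N ->
  expo (ins_at i m) k = if k == i then 0%N else expo m (unbump i k).
Proof. by move=> lt_k; rewrite -[k]/(val (Ordinal lt_k)) -mnm_nth mnmE. Qed.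

Lemma expoP (m1 m2 : 'X_{1..n}) :
  (forall k, (k < n)%N -> expo m1 k = expo m2 k) -> m1 = m2.
Proof. by move=> E; apply/mnmP => k; rewrite !expoE; apply: E. Qed.

(** The factor at position i is 0 raised to the power 0. *)
Lemma prod_shift (A : comNzRingType) (y : nat -> A) (e : nat -> nat) i N :
  (i <= N)%N -> e i = 0%N ->
  \prod_(j < N.+1) shift i y j ^+ e j = \prod_(j < N) y j ^+ e (bump i j).
Proof.
move=> le_iN ei; rewrite (bigD1_ord (Ordinal (le_iN : (i < N.+1)%N))) //= ei expr0 mul1r.
by apply: eq_bigr => j _; rewrite /shift eq_sym (negbTE (neq_bump _ _)) bumpK.
Qed.

Lemma big_ord_dropl (R : Type) (idx : R) (op : Monoid.law idx) N (F : nat -> R) :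
  (0 < N)%N -> F N.-1 = idx -> \big[op/idx]_(j < N) F j = \big[op/idx]_(j < N.-1) F j.
Proof. by case: N => // N _ /= FN; rewrite big_ord_recr /= FN Monoid.mulm1. Qed.

(** The exponent of x_i has to vanish, and is then dropped from the list of
    exponents. *)
Lemma zero_at_mon i (m : 'X_{1..n}) : (i < n)%N ->
  zero_at i 'X_[m] = if expo m i == 0%N then 'X_[del_at i m] else 0.
Proof.
move=> lt_i; rewrite zero_atE comp_mpolyX; case: eqP => [ei|/eqP ne].
  rewrite (eq_bigr (fun j : 'I_n => shift i (xvar n) j ^+ expo m j)) => [|j _]; last first.
    by rewrite tnth_mktuple expoE.
  have := @prod_shift _ (xvar n) (fun k => expo m k) i n.-1; rewrite (ltn_predK lt_i) => -> //.
    rewrite mpolyXE_id (eq_bigr (fun j : 'I_n => xvar n j ^+ expo m (bump i j))) => [|j _].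
      rewrite [RHS](big_ord_dropl _ (F := fun j => xvar n j ^+ expo m (bump i j))) //.
        by lia.
      by rewrite expo_ge //; rewrite /bump; lia.
    by rewrite xvarE expoE expo_del.
  by lia.
rewrite (bigD1 (Ordinal lt_i)) //= tnth_mktuple /= /shift eqxx expr0n expoE /=.
by rewrite (negbTE ne) mul0r.
Qed.

(** Inserting the exponent 0 at position i is inverse to dropping it; the last
    exponent has to be 0 because R_i f does not involve the last variable. *)
Lemma mcoeff_zero_at i f m : (i < n)%N ->
  (zero_at i f)@_m = if expo m n.-1 == 0%N then f@_(ins_at i m) else 0.
Proof.
move=> lt_i; elim/mpolyind: f => [|c k p _ _ IH].
  by rewrite raddf0 !mcoeff0 if_same.
rewrite raddfD /= !mcoeffD IH -mul_mpolyC rmorphM /= zero_atC !mcoeffCM zero_at_mon //.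
rewrite !mcoeffX.
have -> : (if expo k i == 0%N then 'X_[del_at i k] else 0 : Pol)@_m =
          ((expo m n.-1 == 0%N) && (k == ins_at i m))%:R.
  transitivity (((expo k i == 0%N) && (del_at i k == m))%:R : int).
    by case: ifP => _; rewrite ?mcoeffX ?mcoeff0.
  congr (nat_of_bool _)%:R; apply/andP/andP => -[/eqP e0 /eqP E].
    split; apply/eqP.
      by rewrite -E expo_del ?expo_ge ?/bump; lia.
    apply: expoP => l lt_l; rewrite expo_ins //; case: eqP => [->//|ne].
    rewrite -E expo_del; last by rewrite /unbump; lia.
    by congr nth; rewrite /bump /unbump; lia.
  split; apply/eqP; first by rewrite E expo_ins // eqxx.
  apply: expoP => l lt_l; rewrite expo_del //.
  have [lt_b|le_b] := ltnP (bump i l) n.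
    rewrite E expo_ins // ifF; last by rewrite /bump; lia.
    by congr nth; rewrite /bump /unbump; lia.
  rewrite expo_ge //; suff -> : l = n.-1 by rewrite e0.
  by move: le_b; rewrite /bump; lia.
by case: (expo m n.-1 == 0%N); rewrite ?addr0 ?mulr0 ?addr0.
Qed.

Lemma mdeg_ins_at i m : (i < n)%N -> expo m n.-1 = 0%N -> mdeg (ins_at i m) = mdeg m.
Proof.
move=> lt_i m0; rewrite !mdegE (bigD1_ord (Ordinal lt_i)) //= expoE expo_ins // eqxx add0n.
transitivity (\sum_(j < n.-1) expo m j)%N; last first.
  rewrite -(big_ord_dropl _ (F := fun j => expo m j)) //; last by lia.
  by apply: eq_bigr => j _; rewrite expoE.
apply: eq_bigr => j _; rewrite expoE expo_ins /=; last by have := ltn_ord j; rewrite /bump; lia.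
by rewrite eq_sym (negbTE (neq_bump _ _)) bumpK.
Qed.

(** A predicate on degrees rather than a bound, so as to cover lower and upper
    bounds at once. *)
Definition degrees_in (P : pred nat) f := forall m, ~~ P (mdeg m) -> f@_m = 0.

Lemma degrees_in_zero_at P i f : (i <= n)%N -> degrees_in P f -> degrees_in P (zero_at i f).
Proof.
rewrite leq_eqVlt => /orP[/eqP->|lt_i] Hf m nP; first by rewrite zero_at_n Hf.
by rewrite mcoeff_zero_at //; case: eqP => // m0; rewrite Hf // mdeg_ins_at.
Qed.

Lemma degrees_in_trim P i f : (i < n)%N -> degrees_in P f ->
  degrees_in (fun d => P d.+1) (trim i f).
Proof.
move=> lt_i Hf m nP.
have <- : (xvar n i * trim i f)@_(U_(Ordinal lt_i) + m) = (trim i f)@_m.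
  by rewrite mulrC -[i]/(val (Ordinal lt_i)) xvarE mcoeffMX.
rewrite trimE // mcoeffB !(degrees_in_zero_at _ Hf) ?subrr ?(ltnW lt_i) //.
all: by rewrite mdegD mdeg1 add1n.
Qed.

Lemma degrees_inM k f g : degrees_in (leq k) g -> degrees_in (leq k) (f * g).
Proof.
move=> Hg m nP; rewrite mcoeffM big1 // => -[m1 m2] /= /eqP E.
rewrite [g@_ _]Hg ?mulr0 //; apply: contra nP => /leq_trans; apply.
by have := congr1 (@mdeg n) E; rewrite mdegD; lia.
Qed.

Definition trim_word w f := foldl (fun f i => trim i f) f w.

Lemma trim_word_cat u v f : trim_word (u ++ v) f = trim_word v (trim_word u f).
Proof. exact: foldl_cat. Qed.

Lemma trim_word_is_additive w : zmod_morphism (trim_word w).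
Proof. by elim: w => // i w IH f g /=; rewrite raddfB IH. Qed.

HB.instance Definition _ w :=
  GRing.isZmodMorphism.Build Pol Pol (trim_word w) (trim_word_is_additive w).

Lemma degrees_in_trim_word P w f : all (fun i => i < n)%N w -> degrees_in P f ->
  degrees_in (fun d => P (size w + d)%N) (trim_word w f).
Proof.
elim: w P f => //= i w IH P f /andP[lt_i Hw] Hf.
by have := IH _ _ Hw (degrees_in_trim lt_i Hf); congr degrees_in.
Qed.

(** Quasisymmetry in the first m variables, in terms of trimming. *)
Definition qsym_below m g := forall i, (i.+1 < m)%N -> trim i g = 0.

(** T_i g = 0 identifies R_i with R_(i+1) on g, one i after the other. *)
Lemma qsym_below_eq m g i : (m <= n)%N -> qsym_below m g -> (i < m)%N ->
  zero_at i g = zero_at 0 g.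
Proof.
move=> le_m Hg; elim: i => // i IH lt_i; rewrite -IH ?(ltnW lt_i) //.
by apply/trim_eq0; [lia | apply: Hg].
Qed.

(** R_j R_0 g = R_0 R_(j+1) g = R_0 R_0 g by commutation of substitutions. *)
Lemma qsym_below_zero_at m g : (m <= n)%N -> qsym_below m g -> qsym_below m.-1 (zero_at 0 g).
Proof.
move=> le_m Hg i lt_i; apply/trim_eq0; first by lia.
have E j : (j.+1 < m)%N -> zero_at j (zero_at 0 g) = zero_at 0 (zero_at 0 g).
  move=> lt_j; have := @zero_at_comm 0 j.+1 g.
  by rewrite (@qsym_below_eq m g j.+1) //= => -> //; lia.
by rewrite !E //; lia.
Qed.

(** Each letter of the word is trimmed by the Leibniz rule. The second factor
    then loses its last variable, which for a quasisymmetric polynomial has the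
    same effect as inserting 0 at position 0. *)
Lemma trim_word_mul_qsym m w f g : (m <= n)%N -> admissible m w -> qsym_below m g ->
  trim_word w (f * g) = trim_word w f * iter (size w) (zero_at 0) g.
Proof.
elim: w m f g => //= i w IH m f g le_m /andP[lt_i Hw] Hg.
rewrite trimM; [|lia|exact: Hg].
rewrite (@qsym_below_eq m) //.
rewrite (IH m.-1) //; [by rewrite -iterSr|lia|exact: qsym_below_zero_at].
Qed.

End Operators.

(** * Trimming forest polynomials *)

Lemma treesum_rmorph (A B : comNzRingType) (phi : {rmorphism A -> B}) x t U b :
  phi (treesum x t U b) = treesum (phi \o x) t U b.
Proof.
elim: t U b => [|l IHl r IHr] U b /=; first exact: rmorph1.
by rewrite rmorph_sum; apply: eq_bigr => k _; rewrite !rmorphM IHl IHr.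
Qed.

Section ForestSums.
Variables (A : comNzRingType) (x : nat -> A).

Lemma forestsum_shift i U F : forestsum (shift i x) U F = forestsum x (unbump i \o U) F.
Proof. by apply: eq_bigr => k _; rewrite treesum_shift. Qed.

(** The bounds after R_(i+1) and after R_i: they differ at leaf i only, where
    the label i is allowed by the former. *)
Lemma flags_at_unbump i : flags_at i i (unbump i.+1 \o S) (unbump i \o S).
Proof. by split=> [m ne||| m lt_m|]; rewrite /= /unbump; lia. Qed.

Lemma forestsum_notin i F : i \notin LTer F ->
  forestsum x (unbump i.+1 \o S) F = forestsum x (unbump i \o S) F.
Proof.
move=> nF; apply: eq_bigr => k _.
have [/andP[le_i lt_i]|out] := boolP (offset F k <= i < offset F k + nleaves (F k))%N.
  have := flags_at_unbump i; rewrite -{2}(subnKC le_i) => /flags_atr fl.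
  apply: (treesum_notin _ fl) => //; apply: contra nF => Hj.
  by apply/LTerP; exists (k : nat), (i - offset F k)%N; rewrite subnKC.
apply: eq_treesum => j lt_j; have [H _ _ _ _] := flags_at_unbump i; apply/esym/H.
by apply: contra out => /eqP <-; rewrite leq_addr ltn_add2l.
Qed.

Lemma forestsum_grow i F :
  forestsum x (unbump i.+1 \o S) (grow F i) =
  forestsum x (unbump i \o S) (grow F i) + x i * forestsum x S F.
Proof.
have [k0 [j0 [lt_j0 Ei]]] := leafP F i.
pose N := (k0.+1 + (fbound F + fbound (grow F i)))%N.
have lt_k0 : (k0 < N)%N by rewrite /N; lia.
rewrite !(@forestsum_widen _ _ _ _ N); try by rewrite /N; lia.
have split_k0 (G : nat -> A) :
    \prod_(k < N) G k = G k0 * \prod_(k < N | k != Ordinal lt_k0) G k.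
  by rewrite (bigD1 (Ordinal lt_k0)).
rewrite (split_k0 (fun k => treesum x (F k) (fun j => (offset F k + j).+1) 0)).
rewrite !(split_k0 (fun k => treesum x (grow F i k)
  (fun j => (unbump _ \o S) (offset (grow F i) k + j)%N) 0)).
have other (U : nat -> nat) : (U = unbump i.+1 \o S \/ U = unbump i \o S) ->
  \prod_(k < N | k != Ordinal lt_k0)
    treesum x (grow F i k) (fun j => U (offset (grow F i) k + j)%N) 0
  = \prod_(k < N | k != Ordinal lt_k0) treesum x (F k) (fun j => (offset F k + j).+1) 0.
  move=> HU; apply: eq_bigr => k ne.
  have {}ne : (k : nat) != k0 by apply: contra ne => /eqP E; apply/eqP/val_inj.
  rewrite {1}Ei grow_at_neq //; apply: eq_treesum => j lt_j; rewrite offset_grow.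
  have := @offset_mono F k.+1 k0; have := @offset_mono F k0.+1 k.
  rewrite !offsetS; move: ne; rewrite neq_ltn => /orP[] lt_k H1 H2.
    by have := H2 lt_k; case: HU => -> /=; rewrite /unbump; lia.
  by have := H1 lt_k; case: HU => -> /=; rewrite /unbump; lia.
rewrite (other _ (or_introl erefl)) (other _ (or_intror erefl)) mulrA -mulrDl; congr (_ * _).
have -> : offset (grow F i) k0 = offset F k0 by rewrite offset_grow; lia.
have -> : grow F i k0 = tgrow (F k0) j0 by rewrite Ei grow_at.
have := flags_at_unbump i; rewrite {2}Ei => /flags_atr fl.
rewrite (treesum_tgrow _ fl) //; congr (_ + _ * _).
by apply: eq_treesum => m _; rewrite /skip /= /unbump /bump; lia.
Qed.

(** R_0 lowers all bounds by one. For a shifted forest this is compensated by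
    the renumbering of the leaves. *)
Lemma forestsum_tau F : forestsum x (unbump 0 \o S) (tau F) = forestsum x S F.
Proof.
pose N := (fbound F + fbound (tau F))%N.
rewrite (@forestsum_widen _ _ _ F N) 1?(@forestsum_widen _ _ _ _ N.+1); try by rewrite /N; lia.
rewrite big_ord_recl tauE mul1r; apply: eq_bigr => k _.
rewrite /= /bump leq0n tauE; apply: eq_treesum => j _.
have := @offset_iter_tau 1 F k; rewrite /= => ->.
by rewrite /unbump; lia.
Qed.

End ForestSums.

Section ForestPoly.
Variable n : nat.
Hypothesis n_gt0 : (0 < n)%N.
Local Notation P := (forest_poly n).

(** A substitution renames the labels, which amounts to changing the bounds. The
    hypothesis makes the values of the variables from n on irrelevant: x_n would
    otherwise be moved to x_(n-1). *)
Lemma zero_at_forest_poly i F : LTFor n F -> (i <= n)%N ->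
  zero_at i (P F) = forestsum (xvar n) (unbump i \o S) F.
Proof.
move=> /allP HF le_i; rewrite forest_polyE // rmorph_prod -forestsum_shift.
apply: eq_bigr => k _; rewrite treesum_rmorph; apply: (@treesum_local _ _ _ _ _ _ n).
  by move=> j Hj; apply: HF; apply/LTerP; exists (k : nat), j.
by move=> j lt_j /=; rewrite zero_at_xvar.
Qed.

Lemma trim_grow i F : LTFor n (grow F i) -> trim i (P (grow F i)) = P F.
Proof.
move=> HF; have [lt_i _] := LTFor_ungrow HF; apply: trim_uniq => //.
by rewrite !zero_at_forest_poly // 1?ltnW // forestsum_grow addrC addKr forest_polyE.
Qed.

Lemma trim_notin i F : LTFor n F -> (i < n)%N -> i \notin LTer F -> trim i (P F) = 0.
Proof.
move=> HF lt_i nF; apply/trim_eq0 => //.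
by rewrite !zero_at_forest_poly // 1?ltnW // forestsum_notin.
Qed.

Lemma iter_zero_at_tau s F : LTFor n (iter s tau F) ->
  iter s (zero_at 0) (P (iter s tau F)) = P F.
Proof.
elim: s => // s IH HF; have HF' : LTFor n (iter s tau F).
  apply/allP => l Hl; have /allP/(_ l.+1) := HF => H.
  by apply/ltnW/H; apply: (@LTer_iter_tau_mem 1).
by rewrite iterSr iterS zero_at_forest_poly // forestsum_tau -forest_polyE // IH.
Qed.

Lemma depends_on_forest_poly j F : (j <= n)%N -> LTFor j F -> depends_on j (P F).
Proof.
move=> le_j /allP HF; apply/depends_onP => // i /andP[le_i lt_i]; apply: trim_notin => //.
  by apply/allP => l /HF; lia.
by apply/negP => /HF; lia.
Qed.

Lemma forest_poly_homog F : P F \is #|` IN F|.-homog.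
Proof.
rewrite /forest_poly; apply: rpred_sum => kappa _.
rewrite mprodXE dhomogX; apply/eqP; rewrite [LHS]mdeg_sum.
by rewrite (eq_bigr (fun=> 1%N)) => [|v _]; rewrite ?mdeg1 // sum1_card cardfE.
Qed.

Lemma forest_poly0 : P forest0 = 1.
Proof.
by rewrite forest_polyE // /forestsum big1 // => k _; rewrite forest0E.
Qed.

Lemma mcoeff0_forest_poly F : (P F)@_0 = (F == forest0)%:R.
Proof.
case: eqP => [->|/eqP nF]; first by rewrite forest_poly0 mcoeff1 eqxx.
rewrite (dhomog_nemf_coeff (forest_poly_homog F)) //.
by apply: contra nF => /eqP E; rewrite -card_IN_eq0 -E; apply/eqP/mdeg0.
Qed.

Lemma trim_word_grow_word F w : LTFor n (grow_word F w) -> trim_word w (P (grow_word F w)) = P F.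
Proof.
elim: w => //= i w IH HF; rewrite trim_grow // IH //.
by have [] := LTFor_ungrow HF.
Qed.

(** Trim letter by letter, as long as a terminal node sits at the current
    letter. *)
Lemma trim_word_forest_poly F w : LTFor n F -> all (fun i => i < n)%N w ->
  (exists2 F', F = grow_word F' w & trim_word w (P F) = P F') \/ trim_word w (P F) = 0.
Proof.
elim: w F => [|i w IH] F HF /=; first by left; exists F.
case/andP=> lt_i Hw; have [/LTer_ungrow [F' E]|nF] := boolP (i \in LTer F); last first.
  by right; rewrite trim_notin // raddf0.
subst F; rewrite trim_grow //; have [_ HF'] := LTFor_ungrow HF.
by case: (IH F' HF' Hw) => [[F'' -> ->]|->]; [left; exists F'' | right].
Qed.

(** Trimming along w and taking the constant term is the coefficient functional
    of the forest built by w. *)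
Lemma mcoeff0_trim_word F w : LTFor n F -> all (fun i => i < n)%N w ->
  (trim_word w (P F))@_0 = (F == grow_word forest0 w)%:R.
Proof.
move=> HF Hw; case: eqP => [E|nE].
  by rewrite {1}E trim_word_grow_word -?E // forest_poly0 mcoeff1 eqxx.
case: (trim_word_forest_poly HF Hw) => [[F' EF ->]|->]; last by rewrite mcoeff0.
by rewrite mcoeff0_forest_poly; case: eqP => // E; rewrite EF E in nE.
Qed.

End ForestPoly.

(** * Quasisymmetry in terms of trimming *)

Section QuasiSymmetry.
Variable n : nat.
Local Notation Pol := {mpoly int[n]}.
Implicit Types (g : Pol) (m : 'X_{1..n}).

(** Up to the order-preserving choice of variables, a monomial is determined by
    its nonzero exponents in order. *)
Definition packed (s : seq nat) := [seq x <- s | x != 0%N].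

Lemma packed_positions m :
  packed m = [seq m p | p <- enum 'I_n & m p != 0%N].
Proof.
have -> : (m : seq nat) = [seq m p | p <- enum 'I_n].
  by rewrite -[LHS](map_tnth_enum m).
by rewrite /packed filter_map.
Qed.

Lemma sorted_enum_ord k : sorted (fun s t : 'I_k => (s < t)%N) (enum 'I_k).
Proof. by have := iota_ltn_sorted 0 k; rewrite -val_enum_ord sorted_map. Qed.

(** The exponents occurring in the definition of quasisymmetric polynomials. *)
Definition spread k (a : 'I_k -> nat) (i : 'I_k -> 'I_n) : 'X_{1..n} :=
  (\sum_(t < k) U_(i t) *+ a t)%MM.

Lemma spreadE k (a : 'I_k -> nat) (i : 'I_k -> 'I_n) p :
  spread a i p = (\sum_(t < k | i t == p) a t)%N.
Proof.
rewrite /spread mnm_sumE [RHS]big_mkcond; apply: eq_bigr => t _.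
by rewrite mulmnE mnm1E; case: eqP => _; rewrite ?mul1n ?mul0n ?muln1 ?muln0.
Qed.

Lemma packed_spread k (a : 'I_k -> nat) (i : 'I_k -> 'I_n) :
  (forall t, 0 < a t)%N -> {homo i : s t / (s < t)%N} ->
  packed (spread a i) = [seq a t | t <- enum 'I_k].
Proof.
move=> a_gt0 i_mono; rewrite packed_positions.
have i_inj : injective i.
  by move=> s t E; apply: val_inj => /=; case: (ltngtP s t) => // /i_mono; rewrite E ltnn.
have at_i t : spread a i (i t) = a t.
  by rewrite spreadE (big_pred1 t) // => s; rewrite inj_eq.
have -> : [seq p <- enum 'I_n | spread a i p != 0%N] = [seq i t | t <- enum 'I_k].
  apply: (@irr_sorted_eq _ (fun p q : 'I_n => (p < q)%N)).
  - by move=> p q r; apply: ltn_trans.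
  - by move=> p; apply: ltnn.
  - by apply: sorted_filter (sorted_enum_ord n) => p q r; apply: ltn_trans.
  - exact: homo_sorted i_mono _ (sorted_enum_ord k).
  move=> p; rewrite mem_filter mem_enum andbT; apply/idP/mapP => [|[t _ ->]].
    rewrite spreadE; apply: contra_neqP => H; apply: big1 => t /eqP E.
    by case: H; exists t; rewrite ?mem_enum.
  by rewrite at_i -lt0n.
by rewrite -map_comp; apply: eq_map => t /=.
Qed.

Lemma spread_packed m :
  exists i : 'I_(size (packed m)) -> 'I_n,
    {homo i : s t / (s < t)%N} /\ m = spread (fun t => nth 0%N (packed m) t) i.
Proof.
pose ps := [seq p <- enum 'I_n | m p != 0%N].
have Eps : size (packed m) = size ps by rewrite packed_positions size_map.
have lt_t (t : 'I_(size (packed m))) : (t < size ps)%N by rewrite -Eps.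
pose i (t : 'I_(size (packed m))) : 'I_n := tnth (in_tuple ps) (Ordinal (lt_t t)).
have iE t p0 : i t = nth p0 ps t by rewrite /i (tnth_nth p0).
have ps_sorted : sorted (fun p q : 'I_n => (p < q)%N) ps.
  by apply: sorted_filter (sorted_enum_ord n) => p q r; apply: ltn_trans.
exists i; split.
  move=> s t lt_st; rewrite (iE _ (i s)) (iE t (i s)).
  by apply: (sorted_ltn_nth _ _ ps_sorted) => //; rewrite ?inE //; move=> p q r; apply: ltn_trans.
apply/mnmP => p; rewrite spreadE.
have nthp t p0 : nth 0%N (packed m) t = m (nth p0 ps t) \/ (size ps <= t)%N.
  case: (leqP (size ps) t) => ?; [by right | left].
  by rewrite packed_positions (nth_map p0).
have ups : uniq ps by rewrite filter_uniq // enum_uniq.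
have [p_ps|p_ps] := boolP (p \in ps).
  have lt_i : (index p ps < size (packed m))%N by rewrite Eps index_mem.
  rewrite (big_pred1 (Ordinal lt_i)) /=; last first.
    move=> t; rewrite (iE _ p); apply/eqP/eqP => [E|->]; last exact: nth_index.
    by apply: val_inj; rewrite /= -E index_uniq.
  have [->|] := nthp (index p ps) p; first by rewrite nth_index.
  by rewrite leqNgt index_mem p_ps.
rewrite big_pred0; first by move: p_ps; rewrite mem_filter mem_enum andbT negbK => /eqP.
by move=> t; apply/eqP => E; rewrite -E (iE _ p) mem_nth in p_ps.
Qed.

Lemma qsym_packedP g : qsym g <->
  (forall m1 m2, packed m1 = packed m2 -> g@_m1 = g@_m2).
Proof.
split=> [qg m1 m2 E|H k a i j a_gt0 i_mono j_mono]; last first.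
  by apply: H; rewrite -/(spread a i) -/(spread a j) !packed_spread.
have [i [i_mono Ei]] := spread_packed m1; have [j [j_mono Ej]] := spread_packed m2.
rewrite Ei Ej; move: j j_mono {Ei Ej}; rewrite -E => j j_mono.
apply: qg => // t; rewrite lt0n.
by have := mem_nth 0%N (ltn_ord t); rewrite mem_filter => /andP[].
Qed.

(** Missing exponents are 0, so that shorter lists describe monomials too. *)
Definition mon_of (s : seq nat) : 'X_{1..n} := [multinom nth 0%N s k | k < n].

Lemma expo_mon_of s k : (k < n)%N -> nth 0%N (mon_of s) k = nth 0%N s k.
Proof. by move=> lt_k; rewrite -[k]/(val (Ordinal lt_k)) -mnm_nth mnmE. Qed.

Lemma mon_ofK m : mon_of m = m.
Proof. by apply: expoP => k lt_k; rewrite expo_mon_of. Qed.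

Lemma ins_at_mon_of s1 s2 : (size (s1 ++ s2) < n)%N ->
  ins_at (size s1) (mon_of (s1 ++ s2)) = mon_of (s1 ++ 0%N :: s2).
Proof.
rewrite size_cat => lt_n; apply: expoP => k lt_k; rewrite expo_ins // [RHS]expo_mon_of //.
rewrite [RHS]nth_cat; case: eqP => [->|ne]; first by rewrite ltnn subnn.
rewrite expo_mon_of; last by rewrite /unbump; lia.
rewrite nth_cat /unbump; case: (ltnP k (size s1)) => [lt_ks|le_sk].
  by rewrite ifT; [congr nth|]; lia.
rewrite ifF; last by lia.
have -> : (k - size s1 = (k.-1 - size s1).+1)%N by lia.
by rewrite /=; congr nth; lia.
Qed.

(** All R_i with i < n agree on g. Comparing coefficients in R_i g and R_(n-1) g
    moves a zero exponent from position i to the end, where it disappears from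
    the list. *)
Lemma mcoeff_mon_of_packed g s1 s2 : qsym_below n g -> (size (s1 ++ s2) <= n)%N ->
  g@_(mon_of (s1 ++ s2)) = g@_(mon_of (s1 ++ packed s2)).
Proof.
move=> qg; elim: s2 s1 => [|x s2 IH] s1; first by [].
rewrite /packed /=; case: eqP => [->|_] /= le_n; last by rewrite -!cat_rcons IH ?cat_rcons.
rewrite -IH; last by move: le_n; rewrite !size_cat /=; lia.
have lt_n : (size (s1 ++ s2) < n)%N by move: le_n; rewrite !size_cat /=; lia.
have e0 : nth 0%N (mon_of (s1 ++ s2)) n.-1 = 0%N.
  by rewrite expo_mon_of ?nth_default //; lia.
have lt_s1 : (size s1 < n)%N by move: lt_n; rewrite size_cat; lia.
have ins i : (i < n)%N -> g@_(ins_at i (mon_of (s1 ++ s2))) = (zero_at 0 g)@_(mon_of (s1 ++ s2)).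
  by move=> lt_i; rewrite -(qsym_below_eq (leqnn n) qg lt_i) mcoeff_zero_at // e0.
rewrite -ins_at_mon_of // ins // -(ins n.-1); last by lia.
congr (g@__); apply: expoP => k lt_k; rewrite expo_ins //; case: eqP => [->//|ne].
by congr nth; rewrite /unbump; lia.
Qed.

Lemma packed_ins_at i m : (i < n)%N -> nth 0%N m n.-1 = 0%N -> packed (ins_at i m) = packed m.
Proof.
move=> lt_i m0; pose s := take n.-1 m.
have sz_s : size s = n.-1 by rewrite size_takel // size_tuple; lia.
have Em : (m : seq nat) = rcons s 0%N.
  by rewrite -m0 -take_nth ?size_tuple; [rewrite take_oversize // size_tuple|]; lia.
have -> : (ins_at i m : seq nat) = take i s ++ 0%N :: drop i s.
  apply: (@eq_from_nth _ 0%N).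
    by rewrite size_tuple size_cat /= size_takel ?size_drop ?sz_s; lia.
  rewrite size_tuple => k lt_k; rewrite expo_ins // nth_cat size_takel; last by lia.
  case: eqP => [->|ne]; first by rewrite ltnn subnn.
  case: (ltnP k i) => [lt_ki|le_ik].
    by rewrite nth_take // Em nth_rcons ifT; [congr nth|]; rewrite /unbump; lia.
  have -> : (k - i = (k - i).-1.+1)%N by lia.
  by rewrite /= nth_drop Em nth_rcons ifT; [congr nth|]; rewrite /unbump; lia.
by rewrite Em /packed filter_cat filter_rcons /= -filter_cat cat_take_drop.
Qed.

(** Both conditions say that coefficients are unchanged when a zero exponent is
    moved. *)
Lemma qsymP g : qsym g <-> qsym_below n g.
Proof.
rewrite qsym_packedP; split=> [H i lt_i|qg m1 m2 E].
  have lt_i' := ltnW lt_i; apply/trim_eq0 => //.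
  apply/mpolyP => m; rewrite (mcoeff_zero_at g m lt_i) (mcoeff_zero_at g m lt_i').
  by case: eqP => // m0; apply: H; rewrite !packed_ins_at.
have K m : g@_m = g@_(mon_of (packed m)).
  by rewrite -{1}(mon_ofK m) (@mcoeff_mon_of_packed g [::]) ?size_tuple.
by rewrite K [RHS]K E.
Qed.

End QuasiSymmetry.

(** * Integral spans and generated ideals *)

Section Spans.
Variable V : zmodType.
Implicit Types (S : V -> Prop) (u v : V).

Lemma zspan_mem S v : S v -> zspan S v.
Proof.
by move=> Sv; exists 1%N, (fun=> 1), (fun=> v); split=> //; rewrite big_ord1 mulr1z.
Qed.

Lemma zspan0 S : zspan S 0.
Proof. by exists 0%N, (fun=> 0), (fun=> 0); split; [case | rewrite big_ord0]. Qed.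

Lemma zspanD S u v : zspan S u -> zspan S v -> zspan S (u + v).
Proof.
move=> [m [c [f [Sf ->]]]] [m' [c' [f' [Sf' ->]]]].
exists (m + m')%N, (fun i => match split i with inl j => c j | inr j => c' j end).
exists (fun i => match split i with inl j => f j | inr j => f' j end).
split; first by move=> i; case: (split i).
rewrite big_split_ord /=; congr (_ + _); apply: eq_bigr => i _.
  by rewrite (unsplitK (inl i)).
by rewrite (unsplitK (inr i)).
Qed.

Lemma zspanMz S v c : zspan S v -> zspan S (v *~ c).
Proof.
move=> [m [d [f [Sf ->]]]]; exists m, (fun i => d i * c), f; split=> //.
by rewrite mulrz_suml; apply: eq_bigr => i _; rewrite mulrzA.
Qed.

Lemma zspan_sum S (I : eqType) (s : seq I) (f : I -> V) (c : I -> int) :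
  (forall i, i \in s -> zspan S (f i *~ c i)) -> zspan S (\sum_(i <- s) f i *~ c i).
Proof.
move=> H; rewrite big_seq; apply: (big_ind (zspan S)) => //; first exact: zspan0.
exact: zspanD.
Qed.

Lemma zspan_sub S S' v : (forall u, S u -> S' u) -> zspan S v -> zspan S' v.
Proof. by move=> H [m [c [f [Sf ->]]]]; exists m, c, f; split=> // i; apply/H/Sf. Qed.

(** Terms belonging to the same index are collected. *)
Lemma zspan_seq (I : choiceType) (D : pred I) (b : I -> V) v :
  zspan (fun u => exists2 i, D i & u = b i) v ->
  exists s (c : I -> int), [/\ uniq s, all D s & v = \sum_(i <- s) b i *~ c i].
Proof.
case=> m [c [f [Hf ->]]].
have /fin_all_exists2 [g Dg fg] : forall j : 'I_m, exists2 i, D i & f j = b i by [].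
pose s := undup (codom g).
exists s, (fun i => \sum_(j < m | g j == i) c j); split.
- exact: undup_uniq.
- by apply/allP => i; rewrite mem_undup => /codomP [j ->].
rewrite (eq_bigr (fun i => \sum_(j < m) if g j == i then b i *~ c j else 0)); last first.
  by move=> i _; rewrite mulrz_sumr big_mkcond.
rewrite exchange_big; apply: eq_bigr => j _.
rewrite fg -big_mkcond (big_rem (g j)) /=; last by rewrite mem_undup codom_f.
rewrite eqxx big_seq_cond big_pred0 ?addr0 // => i.
by rewrite rem_filter ?undup_uniq // mem_filter /= eq_sym; case: (g j == i); rewrite ?andbF.
Qed.

End Spans.

Section Ideals.
Variable R : comNzRingType.
Implicit Types (S : R -> Prop) (p q a : R).

Lemma ideal_gen0 S : ideal_gen S 0.
Proof. by exists 0%N, (fun=> 0), (fun=> 0); split; [case | rewrite big_ord0]. Qed.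

Lemma ideal_genMl S a p : S p -> ideal_gen S (a * p).
Proof. by move=> Sp; exists 1%N, (fun=> a), (fun=> p); rewrite big_ord1. Qed.

Lemma ideal_genD S p q : ideal_gen S p -> ideal_gen S q -> ideal_gen S (p + q).
Proof.
move=> [m [g [f [Sf ->]]]] [m' [g' [f' [Sf' ->]]]].
exists (m + m')%N, (fun i => match split i with inl j => g j | inr j => g' j end).
exists (fun i => match split i with inl j => f j | inr j => f' j end).
split; first by move=> i; case: (split i).
rewrite big_split_ord /=; congr (_ + _); apply: eq_bigr => i _.
  by rewrite (unsplitK (inl i)).
by rewrite (unsplitK (inr i)).
Qed.

Lemma ideal_genM S a p : ideal_gen S p -> ideal_gen S (a * p).
Proof.
move=> [m [g [f [Sf ->]]]]; exists m, (fun i => a * g i), f; split=> //.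
by rewrite mulr_sumr; apply: eq_bigr => i _; rewrite mulrA.
Qed.

Lemma ideal_gen_sum S (I : eqType) (s : seq I) (F : I -> R) :
  (forall i, i \in s -> ideal_gen S (F i)) -> ideal_gen S (\sum_(i <- s) F i).
Proof.
move=> H; rewrite big_seq; apply: (big_ind (ideal_gen S)) => //; first exact: ideal_gen0.
exact: ideal_genD.
Qed.

Lemma ideal_gen_sub S S' p : (forall f, S f -> ideal_gen S' f) -> ideal_gen S p -> ideal_gen S' p.
Proof.
move=> H [m [g [f [Sf ->]]]]; apply: ideal_gen_sum => i _.
exact/ideal_genM/H.
Qed.

Lemma ideal_genMz S p c : ideal_gen S p -> ideal_gen S (p *~ c).
Proof. by rewrite -mulrzl; apply: ideal_genM. Qed.

End Ideals.

(** * Expansion in forest polynomials *)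

Section Main.
Variable n : nat.
Hypothesis n_gt0 : (0 < n)%N.
Local Notation Pol := {mpoly int[n]}.
Local Notation P := (forest_poly n).
Implicit Types f p q : Pol.

Lemma mpolyC_int c : c%:MP = 1 *~ c :> Pol.
Proof. by rewrite -{1}[c]intz rmorph_int. Qed.

(** Expand T_j f, which involves the same variables but has smaller degree, into
    forest polynomials and add a terminal node at leaf j to each of the forests.
    The result h has the same T_j as f, so f - h no longer involves x_j. *)
Lemma depends_on_span j f : (j <= n)%N -> depends_on j f ->
  zspan (fun u => exists2 F, LTFor j F & u = P F) f.
Proof.
elim: j f => [|j IHj] f le_j Df.
  rewrite (depends_on0 Df) mpolyC_int; apply/zspanMz/zspan_mem.
  exists forest0; last by rewrite forest_poly0.
  by apply: For_LTFor; apply: For0.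
have [d] : exists d, degrees_in (fun e => e < d)%N f.
  by exists (msize f) => m; rewrite -leqNgt => /msize_mdeg_ge /memN_msupp_eq0.
elim: d f Df => [|d IHd] f Df deg_f.
  by have -> : f = 0; [apply/mpolyP => m; rewrite mcoeff0 deg_f | apply: zspan0].
have [//||m [c [g [Hg Eg]]]] := IHd (trim j f) _ _.
- exact: depends_on_trim.
- exact: degrees_in_trim deg_f.
have /fin_all_exists2 [G LG gG] : forall i : 'I_m, exists2 F, LTFor j.+1 F & g i = P F by [].
have LTn F : LTFor j.+1 F -> LTFor n F by move=> /allP HF; apply/allP => l /HF; lia.
pose h := \sum_(i < m) P (grow (G i) j) *~ c i.
have Th : trim j h = trim j f.
  rewrite Eg raddf_sum; apply: eq_bigr => i _.
  by rewrite raddfMz /= trim_grow ?gG //; apply/LTn/LTFor_grow.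
have Dh : depends_on j.+1 h.
  move=> i Hi; rewrite rmorph_sum; apply: eq_bigr => l _.
  by rewrite raddfMz /= (depends_on_forest_poly n_gt0 le_j) //; apply: LTFor_grow.
rewrite -(subrK h f); apply: zspanD; last first.
  apply: zspan_sum => i _; apply/zspanMz/zspan_mem; exists (grow (G i) j) => //.
  exact: LTFor_grow.
apply: zspan_sub (IHj _ (ltnW le_j) _) => [u [F HF ->]|].
  by exists F => //; apply/allP => l /(allP HF); lia.
apply/depends_onP => [|i /andP[le_i lt_i]]; first exact: ltnW.
move: le_i; rewrite leq_eqVlt => /orP[/eqP <-|lt_ji].
  by rewrite raddfB /= Th subrr.
rewrite raddfB /= (proj1 (depends_onP _ le_j) Df) ?lt_ji //.
by rewrite (proj1 (depends_onP _ le_j) Dh) ?lt_ji // subrr.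
Qed.

Lemma forest_expansion f : exists s (c : forest -> int),
  [/\ uniq s, all (LTFor n) s & f = \sum_(F <- s) P F *~ c F].
Proof.
apply: zspan_seq; apply: depends_on_span => // i Hi.
by have -> : i = n by [lia]; apply: zero_at_n.
Qed.

Lemma mcoeff0_expansion s (c : forest -> int) w :
  uniq s -> all (LTFor n) s -> all (fun i => i < n)%N w ->
  (trim_word w (\sum_(F <- s) P F *~ c F))@_0 =
  if grow_word forest0 w \in s then c (grow_word forest0 w) else 0.
Proof.
move=> us /allP Hs Hw; rewrite raddf_sum raddf_sum /= big_seq.
rewrite (eq_bigr (fun F => if F == grow_word forest0 w then c F else 0)); last first.
  move=> F /Hs HF; rewrite raddfMz raddfMz /= mcoeff0_trim_word //.
  by case: eqP => _; rewrite ?mul0rz // intz.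
rewrite -big_mkcondr /=; case: ifP => [ws|nws].
  rewrite (big_rem _ ws) /= ws eqxx big_seq_cond big_pred0 ?addr0 // => F.
  by rewrite mem_rem_uniq // inE /=; case: eqP; rewrite ?andbF.
by rewrite big_pred0 // => F; case: eqP => [->|]; rewrite ?nws ?andbF.
Qed.

(** * The ideals of high degree quasisymmetric polynomials *)

(** The word w trims the cofactors of the generators only, so a polynomial
    without terms of degree below k remains; w' is too short to bring such a
    term down to degree 0. *)
Lemma qsym_ideal_vanish k p w w' : qsym_ideal k p -> admissible n w ->
  all (fun i => i < n)%N w' -> (size w' < k)%N -> (trim_word (w ++ w') p)@_0 = 0.
Proof.
move=> [m [g [f [Hf ->]]]] Hw Hw' lt_k; rewrite !raddf_sum /= big1 // => i _.
have [qf [d le_d hf]] := Hf i.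
rewrite trim_word_cat (trim_word_mul_qsym _ (leqnn n)) //; last exact/qsymP.
apply: (degrees_in_trim_word (P := leq k) Hw'); last by rewrite mdeg0 addn0 -ltnNge.
apply: degrees_inM; elim: (size w) => [|s IH] /=; last exact: degrees_in_zero_at.
by move=> m' nP; rewrite (dhomog_nemf_coeff hf) //; apply: contra nP => /eqP ->.
Qed.

(** The forests G star H with |G| >= k, with G replaced by its shift and H by a
    word that builds it. *)
Definition star_forest k F := exists G w,
  [/\ F = grow_word G w, admissible n w, all (fun l => l.+1 == n - size w)%N (LTer G)
    & (k <= #|` IN G|)%N].

Lemma star_forestP k F : star_forest k F <->
  exists G H, [/\ ZigZag n G, For n H, star G H = Some F & (k <= #|` IN G|)%N].
Proof.
split=> [[G [w [-> Hw HG le_k]]]|[G [H [HG HH /starP [G' EG ->] le_k]]]].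
  exists (iter (size w) tau G), (grow_word forest0 w); split.
  - apply/allP => l /LTer_iter_tau [y /(allP HG)] Hy ->.
    by have := admissible_size n_gt0 Hw; lia.
  - exact: For_grow_word.
  - by rewrite (grow_word_fmul G); apply: star_iter_tau; rewrite card_grow_word card_IN0.
  by rewrite card_iter_tau.
have [w EH Hw] := For_word HH; exists G', w; rewrite EH (grow_word_fmul G'); split=> //.
  apply/allP => y Hy; have /allP/(_ (#|` IN H| + y)%N) := HG.
  by rewrite EG LTer_iter_tau_mem // EH card_grow_word card_IN0 => /(_ isT); lia.
by move: le_k; rewrite EG card_iter_tau.
Qed.

Lemma star_idealE k p : star_ideal k p <-> zspan (fun u => exists2 F, star_forest k F & u = P F) p.
Proof.
split; apply: zspan_sub => u.
  case=> G [H [F [HG HH HF le_k ->]]]; exists F => //; apply/star_forestP.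
  by exists G, H.
by case=> F /star_forestP [G [H [HG HH HF le_k]]] ->; exists G, H, F.
Qed.

Lemma star_forest_LTFor k F : star_forest k F -> LTFor n F.
Proof. by case/star_forestP=> G [H [HG HH HF _]]; apply: star_LTFor HF. Qed.

Lemma LTFor_decompose F : LTFor n F -> exists G w w',
  [/\ F = grow_word G w, admissible n w, all (fun l => l.+1 == n - size w)%N (LTer G),
      G = grow_word forest0 w' & all (fun i => i < n)%N w'].
Proof.
move=> HF; have [G [w [EF Hw HG]]] := LTFor_split n_gt0 HF.
have [_ /LTFor_word [w' EG Hw']] : all (fun i => i < n)%N w /\ LTFor n G.
  by apply: LTFor_grow_word; rewrite -EF.
by exists G, w, w'.
Qed.

Lemma qsym_ideal_sub k p : qsym_ideal k p -> star_ideal k p.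
Proof.
move=> Ip; apply/star_idealE; have [s [c [us Hs Ep]]] := forest_expansion p.
rewrite Ep; apply: zspan_sum => F sF.
have [G [w [w' [EF Hw HG EG Hw']]]] := LTFor_decompose (allP Hs F sF).
have [le_k|lt_k] := leqP k #|` IN G|.
  by apply/zspanMz/zspan_mem; exists F => //; exists G, w.
suff -> : c F = 0 by rewrite mulr0z; apply: zspan0.
have := mcoeff0_expansion c (w := w ++ w') us Hs; rewrite grow_word_cat -EG -EF sF -Ep => <-.
  by apply: (qsym_ideal_vanish Ip) => //; move: lt_k; rewrite EG card_grow_word card_IN0.
by rewrite all_cat Hw' admissible_lt.
Qed.

(** Induction on the length of w. Let H be the forest built by w and q the
    product of the polynomials of H and of the shifted G, an element of the
    ideal. A forest G' star H' with nonzero coefficient in q has |G'| >= k; it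
    is treated by induction if |H'| < |H|, and it is G star H otherwise. *)
Lemma star_forest_ideal k F : star_forest k F -> qsym_ideal k (P F).
Proof.
case=> G [w [-> Hw HG le_k]]; have [s] := ubnP (size w).
elim: s G w Hw HG le_k => // s IH G w Hw HG le_k lt_s.
have lt_w := admissible_size n_gt0 Hw.
have [G0 EG0] : exists G0, G0 = iter (size w) tau G by exists (iter (size w) tau G).
have [H EH] : exists H, H = grow_word forest0 w by exists (grow_word forest0 w).
have cardH : #|` IN H| = size w by rewrite EH card_grow_word card_IN0.
have LG0 : all (fun l => l.+1 == n)%N (LTer G0).
  by apply/allP => l; rewrite EG0 => /LTer_iter_tau [y /(allP HG)] Hy ->; lia.
have LTG0 : LTFor n G0 by apply/allP => l /(allP LG0); lia.
have LTH : LTFor n H by rewrite EH; apply/For_LTFor/For_grow_word.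
have qG0 : qsym_below n (P G0).
  move=> i lt_i; apply: trim_notin => //; first exact: ltnW.
  by apply/negP => /(allP LG0); lia.
have [q qE] : exists q, q = P H * P G0 by exists (P H * P G0).
have Iq : qsym_ideal k q.
  rewrite qE; apply: ideal_genMl; split; first exact/qsymP.
  by exists #|` IN G0|; [rewrite EG0 card_iter_tau | apply: forest_poly_homog].
have trimq w1 : admissible n w1 -> size w1 = size w ->
    trim_word w1 (P H) = 1 -> trim_word w1 q = P G.
  move=> Hw1 Ew1 E; rewrite qE (trim_word_mul_qsym _ (leqnn n)) // E mul1r Ew1 EG0.
  by apply: iter_zero_at_tau; rewrite -?EG0.
have LTG : LTFor n G by apply/allP => l /(allP HG); lia.
have [t [c [ut Ht Eq]]] := forest_expansion q.
(* The trimming word of H' can be longer than |H| only if it kills the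
   polynomial of H; if it has length |H| it reduces it to 0 or 1, and to 1 only
   when H' = H. The quasisymmetric factor is then the polynomial of G, on which
   the rest of the word tests G' = G. *)
have trichotomy F' : F' \in t -> [\/ F' = grow_word G w, c F' = 0 | qsym_ideal k (P F')].
  move=> tF'; have [G' [w' [w'' [EF' Hw' HG' EG' Hw'']]]] := LTFor_decompose (allP Ht F' tF').
  have Hall : all (fun i => i < n)%N (w' ++ w'') by rewrite all_cat Hw'' admissible_lt.
  have cF' : c F' = (trim_word (w' ++ w'') q)@_0.
    by rewrite Eq mcoeff0_expansion // grow_word_cat -EG' -EF' tF'.
  have [le_k'|lt_k'] := leqP k #|` IN G'|; last first.
    apply: Or32; rewrite cF' (qsym_ideal_vanish Iq) //.
    by move: lt_k'; rewrite EG' card_grow_word card_IN0.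
  have [lt_w'|le_w'] := ltnP (size w') (size w).
    by apply: Or33; rewrite EF'; apply: IH => //; apply: leq_trans lt_w' _.
  have [[H' EH' TH]|TH] := trim_word_forest_poly n_gt0 LTH (admissible_lt Hw'); last first.
    apply: Or32; rewrite cF' trim_word_cat qE (trim_word_mul_qsym _ (leqnn n)) // TH mul0r.
    by rewrite raddf0 mcoeff0.
  have H'0 : H' = forest0.
    apply/eqP; rewrite -card_IN_eq0; move: le_w'.
    by rewrite -cardH EH' card_grow_word -{2}[size w']add0n leq_add2r leqn0.
  have Ew' : size w' = size w by rewrite -cardH EH' card_grow_word H'0 card_IN0.
  rewrite cF' trim_word_cat trimq //; last by rewrite TH H'0 forest_poly0.
  rewrite mcoeff0_trim_word // -EG'; case: eqP => [EGG'|_]; last exact: Or32.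
  apply: Or31; rewrite EF' (grow_word_fmul G) (grow_word_fmul G') EGG'; congr fmul.
  by rewrite -EH EH' H'0.
have [w0 EG Hw0] := LTFor_word LTG.
have Hall0 : all (fun i => i < n)%N (w ++ w0) by rewrite all_cat Hw0 admissible_lt.
(* The coefficient at G star H is computed with its own trimming word. *)
have c1 : (if grow_word G w \in t then c (grow_word G w) else 0) = 1.
  rewrite {1 2}EG -grow_word_cat -(mcoeff0_expansion c ut Ht Hall0) -Eq trim_word_cat trimq //.
    by rewrite mcoeff0_trim_word // -EG eqxx.
  by rewrite EH trim_word_grow_word -?EH // forest_poly0.
move: c1; case: ifP => // Gt c1.
have -> : P (grow_word G w) = q + (\sum_(F <- rem (grow_word G w) t) P F *~ c F) *~ (-1).
  by rewrite {1}Eq (big_rem _ Gt) /= c1 mulr1z mulrNz mulr1z addrK.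
apply: ideal_genD => //; apply: ideal_genMz; apply: ideal_gen_sum => F'.
rewrite mem_rem_uniq // inE => /andP[/eqP nF' /trichotomy [//|->|IF']].
  by rewrite mulr0z; apply: ideal_gen0.
exact: ideal_genMz.
Qed.

Lemma qsym_ideal_star k p : qsym_ideal k p <-> star_ideal k p.
Proof.
split; first exact: qsym_ideal_sub.
case/star_idealE=> m [c [f [Hf ->]]]; apply: ideal_gen_sum => i _.
by apply: ideal_genMz; have [F HF ->] := Hf i; apply: star_forest_ideal.
Qed.

(** * The case of positive degree: bases *)

Lemma zfree_forest_poly (D : pred forest) :
  (forall F, D F -> LTFor n F) -> zfree D P.
Proof.
move=> HD s c us /allP Hs E F sF; have HF := HD _ (Hs _ sF).
have [w EF Hw] := LTFor_word HF.
have LTs : all (LTFor n) s by apply/allP => F' /Hs /HD.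
by have := mcoeff0_expansion c us LTs Hw; rewrite E raddf0 mcoeff0 -EF sF.
Qed.

Lemma mcoeff_pihomog d f m : (pihomog mdeg d f)@_m = if mdeg m == d then f@_m else 0.
Proof.
rewrite {2}[f]mpolyE pihomogE !raddf_sum /= [LHS]big_mkcond.
transitivity (\sum_(i <- msupp f) if mdeg m == d then (f@_i *: 'X_[i] : Pol)@_m else 0).
  apply: eq_bigr => i _; rewrite mcoeffZ mcoeffX.
  by case: (eqVneq i m) => [->//|_]; rewrite mulr0 !if_same.
by case: ifP => _ //; rewrite big1.
Qed.

Lemma qsym_pihomog d f : qsym f -> qsym (pihomog mdeg d f).
Proof.
move=> /qsym_packedP qf; apply/qsym_packedP => m1 m2 E.
rewrite !mcoeff_pihomog (qf _ _ E).
have mdeg_packed m : mdeg m = sumn (packed (m : 'X_{1..n})).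
  rewrite /mdeg sumnE /packed big_filter [RHS]big_mkcond.
  by apply: eq_bigr => x _; case: eqP.
by rewrite !mdeg_packed E.
Qed.

(** The homogeneous components of a quasisymmetric polynomial are
    quasisymmetric, and the one of degree 0 is the constant term. *)
Lemma qsym_plusE p : qsym_plus p <-> qsym_ideal 1 p.
Proof.
split; apply: ideal_gen_sub => f.
  case=> qf f0; rewrite (pihomog_partitionE (leqnn (msize f))).
  apply: ideal_gen_sum => d _; case: (posnP d) => [->|d_gt0].
    suff -> : pihomog mdeg 0 f = 0 by apply: ideal_gen0.
    apply/mpolyP => m; rewrite mcoeff_pihomog mcoeff0 mdeg_eq0.
    by case: eqP => // ->.
  rewrite -[X in ideal_gen _ X]mul1r; apply: ideal_genMl.
  by split; [apply: qsym_pihomog | exists d => //; apply: pihomogP].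
case=> qf [d d_gt0 hf]; rewrite -[f]mul1r; apply: ideal_genMl; split=> //.
apply: (dhomog_nemf_coeff hf); apply: contraTneq d_gt0 => <-.
by rewrite -leqNgt leqn0; apply/eqP/mdeg0.
Qed.

(** If G star H with G nonempty were in For_n, then its own trimming word would
    be admissible, and the coefficient functional would vanish on the ideal,
    which contains its polynomial; but its value there is 1. *)
Lemma star_forest1 F : star_forest 1 F <-> LTFor n F && ~~ For n F.
Proof.
split=> [HF|/andP[HF nF]].
  rewrite (star_forest_LTFor HF); apply/negP => /For_word [w EF Hw].
  have := @qsym_ideal_vanish 1 _ w [::] (star_forest_ideal HF) Hw isT isT.
  rewrite cats0 mcoeff0_trim_word ?(star_forest_LTFor HF) ?admissible_lt //.
  by rewrite EF eqxx.
have [G [w [EF Hw HG]]] := LTFor_split n_gt0 HF; exists G, w; split=> //.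
rewrite lt0n card_IN_eq0; apply: contra nF => /eqP G0.
by rewrite EF G0 For_grow_word.
Qed.

Lemma qsym_plus_basis :
  zbasis (@qsym_plus n) (fun F : forest => LTFor n F && ~~ For n F) P.
Proof.
split=> [p|]; last by apply: zfree_forest_poly => F /andP[].
rewrite qsym_plusE qsym_ideal_star star_idealE.
by split; apply: zspan_sub => u [F HF ->]; exists F => //; apply/star_forest1.
Qed.

Lemma pi_qscoinv_is_additive : zmod_morphism (\pi_(qscoinv n) : Pol -> qscoinv n).
Proof. exact: pi_is_zmod_morphism. Qed.

HB.instance Definition _ := GRing.isZmodMorphism.Build Pol (qscoinv n)
  (\pi_(qscoinv n)) pi_qscoinv_is_additive.

Lemma pi_qscoinv_eq0 p : \pi_(qscoinv n) p = 0 <-> qsym_plus p.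
Proof.
have := @Quotient.idealrBE _ (Idealr.clone {mpoly int[n]} (@in_qsym_plus n) _) p 0.
rewrite subr0 => E.
have {E} : (p \in @in_qsym_plus n) = (\pi_(qscoinv n) p == \pi_(qscoinv n) 0) by [].
rewrite raddf0 => E; split=> [/eqP|/asboolP H]; first by rewrite -E => /asboolP.
by apply/eqP; rewrite -E.
Qed.

(** Forest polynomials outside For_n vanish in the quotient. The coefficient
    functionals of the forests in For_n vanish on the ideal, since their words
    are admissible, so they detect the coefficients of a relation. *)
Lemma qscoinv_basis :
  zbasis (V := qscoinv n) (fun=> True) (For n) (fun F => \pi_(qscoinv n) (P F)).
Proof.
split=> [v|s c us /allP Hs E F sF].
  split=> // _; rewrite -[v]reprK.
  have [s [c [us Hs ->]]] := forest_expansion (repr v).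
  rewrite raddf_sum /=; rewrite (eq_bigr (fun F => \pi_(qscoinv n) (P F) *~ c F)) => [|F _].
    apply: zspan_sum => F sF; have HF := allP Hs F sF; apply: zspanMz.
    have [FF|nF] := boolP (For n F); first by apply: zspan_mem; exists F.
    suff -> : \pi_(qscoinv n) (P F) = 0 by apply: zspan0.
    apply/pi_qscoinv_eq0/qsym_plusE/star_forest_ideal => //.
    by apply/star_forest1; rewrite ?HF.
  by rewrite raddfMz.
have {}E : qsym_plus (\sum_(F <- s) P F *~ c F).
  apply/pi_qscoinv_eq0; rewrite -[RHS]E raddf_sum; apply: eq_bigr => F' _.
  by rewrite raddfMz.
have [w EF Hw] := For_word (Hs F sF).
have LTs : all (LTFor n) s by apply/allP => F' /Hs /For_LTFor.
have := mcoeff0_expansion c us LTs (admissible_lt Hw).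
rewrite -EF sF => <-; rewrite -[w]cats0.
by apply: (@qsym_ideal_vanish 1) => //; apply/qsym_plusE.
Qed.
End Main.

(** * Catalan numbers and binary trees *)

Section CatalanNumbers.
Local Open Scope nat_scope.

Lemma catalanE n : n.+1 * catalan n = 'C(n.*2, n).
Proof.
have E : 'C(n.*2, n) = n.+1 * ('C(n.*2, n) - 'C(n.*2, n.+1)).
  by rewrite mulnBr mul_bin_left -addnn addnK -mulnBl subSnn mul1n.
by rewrite /catalan {1}E mulKn // -E.
Qed.

Lemma catalan_ratio n : n.+2 * catalan n.+1 = (4 * n + 2) * catalan n.
Proof.
apply/eqP; rewrite -(eqn_pmul2l (ltn0Sn n)) catalanE [X in _ == X]mulnCA catalanE.
have := mul_bin_diag n.*2.+1 n; have := mul_bin_down n.*2.+1 n; rewrite doubleS /=.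
have -> : (n.*2.+1 - n = n.+1)%N by lia.
by move=> H1 H2; rewrite binS mulnDr -H1 -H2 -mulnDl; apply/eqP; congr muln; lia.
Qed.

(** Weight the convolution by the index i. By symmetry the weighted sum W n is
    n/2 times the convolution, and the two-term recurrence of the Catalan
    numbers expresses W n.+1 by W n; this determines the convolution by
    induction. *)
Lemma catalan_convolution n :
  \sum_(i < n.+1) catalan i * catalan (n - i) = catalan n.+1.
Proof.
pose W n := \sum_(i < n.+1) i * (catalan i * catalan (n - i)).
have W2 m : 2 * W m = m * \sum_(i < m.+1) catalan i * catalan (m - i).
  rewrite mul2n -addnn {2}/W (reindex_inj rev_ord_inj) -big_split big_distrr /=.
  apply: eq_bigr => i _; have lt_i := ltn_ord i.
  rewrite subSS subKn; last by lia.
  by rewrite [catalan (m - i) * _]mulnC -mulnDl; congr (_ * _); lia.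
elim: n => [|n IH]; first by rewrite big_ord1.
pose S' := \sum_(i < n.+2) catalan i * catalan (n.+1 - i).
have E : W n.+1 + S' = catalan n.+1 + (4 * W n + 2 * catalan n.+1).
  rewrite -big_split big_ord_recl /= mul0n add0n subn0 mul1n; congr (_ + _).
  rewrite -IH !big_distrr -big_split /=; apply: eq_bigr => i _.
  rewrite /bump add1n subSS !mulnA -!mulnDl; congr (_ * _).
  by have := catalan_ratio i; lia.
have := W2 n.+1; have := W2 n; rewrite IH -/S' => E1 E2.
have := catalan_ratio n.+1 => E3.
apply/eqP; rewrite -(eqn_pmul2l (ltn0Sn n.+2)) E3 -/S'; apply/eqP; nia.
Qed.

(** Here d is fuel: any d >= m yields all trees with m internal nodes. *)
Fixpoint trees d m : seq btree :=
  if m is m'.+1 then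
    if d is d'.+1 then
      [seq Node lr.1 lr.2 | i <- iota 0 m,
         lr <- [seq (l, r) | l <- trees d' i, r <- trees d' (m' - i)]]
    else [::]
  else [:: Leaf].

Lemma treesS d m : trees d.+1 m.+1 =
  [seq Node lr.1 lr.2 | i <- iota 0 m.+1,
     lr <- [seq (l, r) | l <- trees d i, r <- trees d (m - i)]].
Proof. by []. Qed.

Lemma nleaves1 t : (nleaves t == 1) = (t == Leaf).
Proof.
case: t => //= l r; have := nleaves_gt0 l; have := nleaves_gt0 r.
by case: eqP => //; lia.
Qed.

Lemma mem_trees d m t : m <= d -> (t \in trees d m) = (nleaves t == m.+1).
Proof.
elim: d m t => [|d IH] [|m] t // le_d; rewrite ?nleaves1 ?inE // treesS.
apply/allpairsPdep/idP => [[i [[l r] [+ /allpairsP [[l' r'] [/= Hl Hr [-> ->]]] ->]]]|].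
  rewrite mem_iota /= add0n => lt_i; rewrite !IH in Hl Hr; [|lia|lia].
  by rewrite /= (eqP Hl) (eqP Hr); lia.
case: t => // l r /=; have l0 := nleaves_gt0 l; have r0 := nleaves_gt0 r => /eqP E.
exists (nleaves l).-1, (l, r); split=> //.
  by rewrite [in_mem _ _](mem_iota 0 m.+1); lia.
by apply/allpairsP; exists (l, r); split=> //=; rewrite IH; lia.
Qed.

Lemma trees_uniq d m : m <= d -> uniq (trees d m).
Proof.
elim: d m => [|d IH] [|m] // le_d; rewrite treesS.
apply: allpairs_uniq_dep; first exact: iota_uniq.
  move=> i; rewrite mem_iota => lt_i.
  apply: allpairs_uniq; [apply: IH; lia|apply: IH; lia|].
  by move=> [? ?] [? ?] _ _ [-> ->].
have sizes (u : {_ : nat & (btree * btree)%type}) :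
    u \in [seq @Tagged nat i (fun=> (btree * btree)%type) lr | i <- iota 0 m.+1,
           lr <- [seq (l, r) | l <- trees d i, r <- trees d (m - i)]] ->
    nleaves (tagged u).1 = (tag u).+1.
  case/allpairsPdep=> i [lr [+ /allpairsP [[l r] [/= Hl _ ->]] ->]] /=.
  rewrite [in_mem _ _](mem_iota 0 m.+1) => lt_i; have le_i : i <= d by lia.
  by move: Hl; rewrite mem_trees // => /eqP.
move=> [i [l r]] [j [l' r']] /sizes /= Hi /sizes /= Hj [El Er].
by move: Hi; rewrite El Er Hj => -[->].
Qed.

Lemma size_trees d m : m <= d -> size (trees d m) = catalan m.
Proof.
elim: d m => [|d IH] [|m] // le_d.
rewrite -catalan_convolution treesS size_allpairs_dep sumnE big_map.
rewrite -(big_mkord xpredT (fun i => catalan i * catalan (m - i))) /index_iota subn0.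
apply: eq_big_seq => i; rewrite mem_iota => lt_i.
by rewrite size_allpairs !IH //; lia.
Qed.

End CatalanNumbers.

(** The left subtrees along the right spine. The tree is recovered from this
    list, whose trees have one leaf less in total. *)
Fixpoint spine t : seq btree := if t is Node l r then l :: spine r else [::].

Definition forest_of (s : seq btree) : forest :=
  [fsfun k in [fset j in iota 0 (size s)]%fset => nth Leaf s k].

Lemma forest_ofE s k : forest_of s k = nth Leaf s k.
Proof.
rewrite fsfunE !inE mem_iota /= add0n; case: ltnP => // le_k.
by rewrite nth_default.
Qed.

Lemma spine_foldr s : spine (foldr Node Leaf s) = s.
Proof. by elim: s => //= t s ->. Qed.

Lemma nleaves_spine t : nleaves t = (sumn (map nleaves (spine t))).+1.
Proof. by elim: t => //= l _ r ->; rewrite addnS. Qed.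

Lemma offset_forest_of s : offset (forest_of s) (size s) = sumn (map nleaves s).
Proof.
rewrite sumnE big_map (big_nth Leaf) big_mkord; apply: eq_bigr => k _.
by rewrite forest_ofE.
Qed.

(** A forest does not see trailing trivial trees on the spine, but the number of
    leaves does. *)
Lemma forest_of_spine_inj t t' : nleaves t = nleaves t' ->
  forest_of (spine t) = forest_of (spine t') -> t = t'.
Proof.
move=> En /fsfunP E; have {}E k : nth Leaf (spine t) k = nth Leaf (spine t') k.
  by rewrite -!forest_ofE E.
elim: t t' En E => [|l _ r IHr] [|l' r'] //= En E.
- by have := nleaves_gt0 l'; have := nleaves_gt0 r'; lia.
- by have := nleaves_gt0 l; have := nleaves_gt0 r; lia.
have El : l = l' := E 0%N; subst l'; congr Node; apply: IHr => [|k]; first by lia.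
exact: (E k.+1).
Qed.

Definition forests n := [seq forest_of (spine t) | t <- trees n n].

Lemma forests_uniq n : uniq (forests n).
Proof.
rewrite map_inj_in_uniq ?trees_uniq // => t t'; rewrite !mem_trees // => /eqP Et /eqP Et'.
by apply: forest_of_spine_inj; rewrite Et Et'.
Qed.

Lemma size_forests n : size (forests n) = catalan n.
Proof. by rewrite size_map size_trees. Qed.

Lemma mem_forests n (F : forest) : (F \in forests n) = For n F.
Proof.
apply/mapP/ForP => [[t + ->] k|HF].
  rewrite mem_trees // nleaves_spine eqSS => /eqP <-; rewrite -offset_forest_of forest_ofE.
  by case: (ltnP k (size (spine t))) => [lt_k _|le_k]; [apply: offset_mono | rewrite nth_default].
(* The leaf n is a trivial tree of F, and it comes right after the trees that
   share the first n leaves. *)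
have [m [j [lt_j En]]] := leafP F n.
have Fm : F m = Leaf by apply/eqP/negPn/negP => /HF; rewrite offsetS; lia.
move: lt_j; rewrite Fm ltnS leqn0 => /eqP j0; rewrite j0 addn0 in En.
exists (foldr Node Leaf (mkseq F m)).
  rewrite mem_trees // nleaves_spine spine_foldr sumnE big_map big_map En.
  by rewrite /offset -(big_mkord xpredT (fun k => nleaves (F k))) /index_iota subn0.
apply/fsfunP => k; rewrite spine_foldr forest_ofE.
have [lt_k|le_k] := ltnP k m; first by rewrite nth_mkseq.
rewrite nth_default ?size_mkseq //; apply/eqP/negPn/negP => /HF.
by have := @offset_lt F m k.+1; lia.
Qed.

(** * The rank of the coinvariants *)

Lemma zbasis_enum (V : zmodType) (M : V -> Prop) (I : eqType) (x0 : I) (D : pred I)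
    (b : I -> V) (s : seq I) :
  uniq s -> s =i D -> zbasis M D b ->
  zbasis M predT (fun i : 'I_(size s) => b (nth x0 s i)).
Proof.
move=> us sD [HM Hfree]; split=> [v|r c ur _ E i ri].
  rewrite HM; split; apply: zspan_sub => u [i Di ->].
    have lt_i : (index i s < size s)%N by rewrite index_mem sD.
    by exists (Ordinal lt_i); rewrite //= nth_index // sD.
  by exists (nth x0 s i) => //; rewrite -[D _]sD mem_nth.
pose c' x := if insub (index x s) is Some j then c j else 0.
have c'E (j : 'I_(size s)) : c' (nth x0 s j) = c j.
  by rewrite /c' index_uniq // valK.
rewrite -c'E; apply: (Hfree [seq nth x0 s (j : 'I_(size s)) | j <- r]).
- rewrite map_inj_uniq // => j k /eqP; rewrite nth_uniq // => /eqP E'.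
  exact: val_inj.
- by apply/allP => x /mapP [j _ ->]; rewrite -[D _]sD mem_nth.
- by rewrite big_map -[RHS]E; apply: eq_bigr => j _; rewrite c'E.
exact: map_f.
Qed.

Lemma qscoinv_rank n : (0 < n)%N -> zrank (qscoinv n) (catalan n).
Proof.
move=> n_gt0; rewrite -size_forests.
exists (fun i => \pi_(qscoinv n) (forest_poly n (nth forest0 (forests n) i))).
apply: (zbasis_enum (b := fun F => \pi_(qscoinv n) (forest_poly n F)) forest0 (forests_uniq n)).
  exact: mem_forests.
exact: qscoinv_basis.
Qed.

Theorem theorem9p7 :
  (forall (k n : nat), (0 < n)%N ->
     forall p : {mpoly int[n]}, qsym_ideal k p <-> star_ideal k p) /\
  (forall n : nat, (0 < n)%N ->
     [/\ zbasis (@qsym_plus n)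
           (fun F : forest => LTFor n F && ~~ For n F) (forest_poly n),
         zbasis (V := qscoinv n) (fun=> True)
           (For n) (fun F : forest => \pi_(qscoinv n) (forest_poly n F))
       & zrank (qscoinv n) (catalan n)]).
Proof.
split=> [k n n_gt0 p|n n_gt0]; first exact: qsym_ideal_star.
split; [exact: qsym_plus_basis | exact: qscoinv_basis | exact: qscoinv_rank].
Qed.
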